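(* The following holds for every constant $\varepsilon>0$. Let $G$ be a connected $d$-regular vertex-transitive graph on $n$ vertices and let $p\in[0,1]$ satisfy $p^2d=\omega(\log n)$. Let $V_p$ be a $p$-random subset of $V(G)$. Then $G[V_p]$ is $(1-\varepsilon)$-tough with probability at least $1-2^{-\Omega(p^2d)}$.
   Context: All graphs are finite and simple. A graph is vertex-transitive if for any two vertices there is an automorphism mapping one to the other. A graph $H$ is $s$-tough if for every $S\subseteq V(H)$ such that $H-S$ has $k\geq 2$ connected components, $|S|\geq sk$ (so complete graphs are $s$-tough for every $s$). A $p$-random subset $V_p$ of $V(G)$ contains every vertex independently with probability $p$. Asymptotic notation is with respect to $n\to\infty$: $p^2d=\omega(\log n)$ means $p^2d/\log n\to\infty$; the constant hidden in $\Omega(\cdot)$ is positive and may depend only on $\varepsilon$; the statement is for all sufficiently large $n$ (where how large may depend only on $\varepsilon$ and on the rate of divergence in the $\omega(\cdot)$ hypothesis). *)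

(* Defs.v *)
From mathcomp Require Import all_boot all_order all_algebra all_fingroup.
Import Order.TTheory GRing.Theory Num.Theory.

Set Implicit Arguments.
Unset Strict Implicit.
Unset Printing Implicit Defensive.

Local Open Scope ring_scope.

Definition simple_graph (T : finType) (e : rel T) : Prop :=
  symmetric e /\ irreflexive e.

Definition graph_connected (T : finType) (e : rel T) : Prop :=
  forall x y : T, connect e x y.

Definition regular_graph (T : finType) (e : rel T) (d : nat) : Prop :=
  forall x : T, #|[set y | e x y]| = d.

Definition automorphism (T : finType) (e : rel T) (s : {perm T}) : Prop :=
  forall x y : T, e (s x) (s y) = e x y.

Definition vertex_transitive (T : finType) (e : rel T) : Prop :=
  forall x y : T, exists2 s : {perm T}, automorphism e s & s x = y.

Definition induced_subgraph (T : finType) (e : rel T) (W : {set T}) :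
    rel {x : T | x \in W} :=
  fun x y => e (val x) (val y).
Arguments induced_subgraph {T} e W x y.

(* n_comp counts connected components only when e is symmetric. *)
Definition num_components (T : finType) (e : rel T) : nat := n_comp e T.

(* The graph H - S is encoded as the subgraph of H induced by ~: S. *)
Definition tough (R : numDomainType) (T : finType) (e : rel T) (s : R) : bool :=
  [forall S : {set T},
    let k := num_components (induced_subgraph e (~: S)) in
    (2 <= k)%N ==> (s * k%:R <= #|S|%:R)].

(* Vertices are kept independently with probability p, so the p-random subset
   equals W with probability p ^ #|W| * (1 - p) ^ #|~: W|. *)
Definition prob_random_subset (R : numDomainType) (T : finType) (p : R)
    (A : pred {set T}) : R :=
  \sum_(W : {set T} | A W) \prod_(x : T) (if x \in W then p else 1 - p).

(* Main.v *)
Require Import Defs.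
From mathcomp Require Import all_classical all_reals all_analysis.
From mathcomp Require Import all_boot all_order all_algebra all_fingroup.
From mathcomp Require Import ring lra zify.
Import Order.TTheory GRing.Theory Num.Theory.

Set Implicit Arguments.
Unset Strict Implicit.
Unset Printing Implicit Defensive.

Local Open Scope ring_scope.

(** Let [H] be the graph induced by the random set [W], of expected degree
    about [p d], and suppose that deleting [S] leaves [k] components with
    [#|S| < (1 - eps) k].  A component sending about [p d] edges to [S] is paid
    for by the degrees of [S], and there are at most [(1 + o(1)) #|S|] of those.
    All other components meet a well connected core of the sampled graph; if
    there are [t] of them, then [t >= 2] and [#|S| <= K t] with [K] about
    [2 / eps] ([separator_splits_core]).  It remains to see that no [S] of size
    at most [K t] separates [t] such large pieces.

    Counting edges does not suffice for this: two large pieces of the host graph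
    may be joined by a perfect matching of [d] edges, of which only about [p^2 d]
    survive, far fewer than [p d].  The edges have to be reweighted.  Choose a
    shortest path between any two distinct vertices, average the paths over all
    automorphisms, and let [w u v] be the normalised traffic through the edge
    [u v].  Vertex transitivity makes the traffic through every vertex equal to
    one.  If every vertex of a set [A] has a constant fraction of its [d]
    neighbours in [A], then a shortest path meets [A] in [O(#|A| / d)] vertices
    only, because vertices far apart on it have disjoint neighbourhoods.  Hence a
    path that visits [A] soon leaves it, unless [#|A|] is large compared with [d]
    times the length of the path, and then end points on different sides of [A]
    are frequent enough.  Both effects together give a cut of [w]-weight at
    least a constant times [d], whatever the size of [A] (up to half of the
    graph): [geo_isoperimetry].

    Two facts about such weights replace edge counting.  A weight with bounded
    vertex sums concentrates under vertex sampling: between two independent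
    [q]-random sets, the probability that a constant amount survives out of a
    total [B] is exponentially small in [q^2 B] ([bilinear_laplace_le]).  And if
    every partition into [k] classes cuts weight at least [k lam], then at most
    [n^(2a)] partitions cut weight at most [a lam], by the contraction argument of
    Karger ([count_light_colorings]).  As [lam] is of order [d] and [p^2 d] is
    large compared with [log n], a union bound over partitions is affordable.

    To apply them, [W] is generated as the union of three independent random sets
    [W0], [B], [C] of densities about [p / 3].  The set [W0] provides the vertices
    to be partitioned: for each of the [n^(O(#|S0|))] sets [S0], to be thought of
    as the intersection of [S] and [W0], the components of [W0] minus [S0] are
    determined, and every vertex of the graph is shared out among the components
    to which its neighbours in [W0] belong.  The components of [H] minus [S] merge
    these components into [t] classes, and this partition cuts weight at least
    [t lam] ([candidate_cut], from [core_cut_ge]).  But an edge between [B] and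
    [C] that avoids [S] lies within one component of [H] minus [S], so that the
    surviving part of the cut weight is at most [2 #|S| <= 2 K t]
    ([crossing_le]), which is exponentially unlikely for all partitions at once
    ([candidate_sum], [expectation_bad_candidates]). *)

(** * Random vertex subsets *)

Section RandomSubset.
Variables (R : realType) (T : finType).
Implicit Types (p q r : R) (phi psi : {set T} -> R).

Definition subset_weight p (W : {set T}) : R := \prod_x (if x \in W then p else 1 - p).

Definition expectation p phi : R := \sum_W subset_weight p W * phi W.

Lemma expectation_prod p (h : T -> R) :
  expectation p (fun W => \prod_(x in W) h x) = \prod_x (p * h x + (1 - p)).
Proof.
rewrite bigA_distr; apply: eq_big => [W|W _]; first by rewrite inE.
rewrite /subset_weight [X in _ * X]big_mkcond -big_split /=; apply: eq_bigr => x _.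
by case: ifP; rewrite ?mulr1.
Qed.

Lemma expectation_cst p (c : R) : expectation p (fun=> c) = c.
Proof.
rewrite /expectation -mulr_suml.
have -> : \sum_W subset_weight p W = expectation p (fun W => \prod_(x in W) 1).
  by apply: eq_bigr => W _; rewrite big1 ?mulr1.
rewrite expectation_prod big1 ?mul1r // => x _; by rewrite mulr1 addrC subrK.
Qed.

Lemma subset_weight_ge0 p W : 0 <= p <= 1 -> 0 <= subset_weight p W.
Proof. by move=> /andP[p0 p1]; apply: prodr_ge0 => x _; case: ifP; rewrite ?subr_ge0. Qed.

Lemma expectation_le p phi psi : 0 <= p <= 1 -> (forall W, phi W <= psi W) ->
  expectation p phi <= expectation p psi.
Proof. by move=> p01 h; apply: ler_sum => W _; rewrite ler_wpM2l ?subset_weight_ge0. Qed.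

Lemma expectationD p phi psi :
  expectation p (fun W => phi W + psi W) = expectation p phi + expectation p psi.
Proof. by rewrite -big_split; apply: eq_bigr => W _; rewrite mulrDr. Qed.

Lemma expectationZ p c phi :
  expectation p (fun W => c * phi W) = c * expectation p phi.
Proof. by rewrite mulr_sumr; apply: eq_bigr => W _; rewrite mulrCA. Qed.

Lemma expectation_sum p (I : finType) (P : pred I) (phi : I -> {set T} -> R) :
  expectation p (fun W => \sum_(i | P i) phi i W) = \sum_(i | P i) expectation p (phi i).
Proof.
rewrite /expectation exchange_big; apply: eq_bigr => W _; exact: mulr_sumr.
Qed.

Lemma subset_weight_setU p q r W : 1 - p = (1 - q) * (1 - r) ->
  \sum_A \sum_(B | A :|: B == W) subset_weight q A * subset_weight r B = subset_weight p W.
Proof.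
move=> pqr.
pose m (a b c : bool) : R := ((a || b) == c)%:R * (if a then q else 1 - q) * (if b then r else 1 - r).
have E A B : (A :|: B == W)%:R * (subset_weight q A * subset_weight r B) =
    \prod_x m (x \in A) (x \in B) (x \in W).
  rewrite /m !big_split /= -mulrA; congr (_ * _).
  have [/eqP<-|/eqP ne] := boolP (A :|: B == W).
    by rewrite big1 // => x _; rewrite inE eqxx.
  have /existsP[x nx] : [exists x, (x \in A :|: B) != (x \in W)].
    by apply/contraT => /existsPn h; case: ne; apply/setP => x; apply/eqP/negPn/h.
  by move: nx; rewrite inE => /negPf nx; rewrite (bigD1 x) //= nx mul0r.
transitivity (\sum_(A : {set T}) \prod_(x : T) (m (x \in A) true (x \in W) + m (x \in A) false (x \in W))).
  apply: eq_bigr => A _; rewrite bigA_distr big_mkcond; apply: eq_big => [B|B _]; first by rewrite inE.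
  transitivity (\prod_x m (x \in A) (x \in B) (x \in W)).
    by rewrite -E; case: eqP; rewrite ?mul1r ?mul0r.
  by apply: eq_bigr => x _; case: (x \in B).
transitivity (\prod_(x : T) ((m true true (x \in W) + m true false (x \in W)) +
    (m false true (x \in W) + m false false (x \in W)))).
  rewrite bigA_distr; apply: eq_big => [A|A _]; first by rewrite inE.
  by apply: eq_bigr => x _; case: (x \in A).
apply: eq_bigr => x _; rewrite /m; case: (x \in W) => /=; last by rewrite !mul0r !mul1r !add0r.
rewrite !mul0r !mul1r ?addr0.
have -> : p = 1 - (1 - q) * (1 - r) by rewrite -pqr; ring.
ring.
Qed.

(** Generating the random set in independent rounds: a vertex is missed by the
    union exactly when it is missed by both rounds. *)
Lemma expectation_setU p q r phi : 1 - p = (1 - q) * (1 - r) ->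
  expectation p phi = expectation q (fun A => expectation r (fun B => phi (A :|: B))).
Proof.
move=> pqr; rewrite /expectation.
under eq_bigr do rewrite -(subset_weight_setU _ pqr) mulr_suml.
rewrite exchange_big /=; apply: eq_bigr => A _; rewrite mulr_sumr.
under eq_bigr do rewrite mulr_suml.
rewrite (exchange_big_dep predT) //=; apply: eq_bigr => B _.
by rewrite (big_pred1 (A :|: B)) ?mulrA // => W; rewrite /= eq_sym.
Qed.

Lemma expectation_exp p (h : T -> R) :
  expectation p (fun W => expR (\sum_(x in W) h x)) = \prod_x (p * expR (h x) + (1 - p)).
Proof. by rewrite -expectation_prod; apply: eq_bigr => W _; rewrite expR_sum. Qed.

(** Weighted Chernoff bound for the lower tail, in the form of a Laplace
    transform; it comes from [exp (- b) <= 1 - b / 2] on [0, 1]. *)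
Lemma linear_laplace_le p (b : T -> R) : 0 <= p <= 1 -> (forall x, 0 <= b x <= 1) ->
  expectation p (fun W => expR (- \sum_(x in W) b x)) <= expR (- (p / 2 * \sum_x b x)).
Proof.
move=> /andP[p0 p1] b01; rewrite -mulrN -sumrN mulr_sumr expR_sum.
under [X in expectation p X]eq_fun do rewrite -sumrN.
rewrite expectation_exp; apply: ler_prod => x _; have /andP[b0 b1] := b01 x.
have eb : expR (- b x) <= 1 - b x / 2.
  have b1' : 0 < 1 + b x by lra.
  rewrite -(ler_pM2r b1'); apply: (@le_trans _ _ 1).
    rewrite -[leRHS](expRxMexpNx_1 (b x)) mulrC ler_wpM2r ?expR_ge0 //; exact: expR_ge1Dx.
  have := mulr_ge0 b0 (_ : 0 <= 1 - b x); rewrite subr_ge0 => /(_ b1); lra.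
have e0 := expR_ge0 (- b x); have pe := ler_wpM2l p0 eb.
rewrite addr_ge0 ?mulr_ge0 ?subr_ge0 //=; apply: le_trans (expR_ge1Dx _).
lra.
Qed.

(** Lower tail for the weight between two independent random sets.  Exposing one
    set after the other turns a quadratic form into two linear ones, so that no
    correlation inequality is needed; the bounds on row and column sums keep the
    exponents of both steps within [0, 1]. *)
Lemma bilinear_laplace_le q r (b : T -> T -> R) : 0 <= q <= 1 -> 0 <= r <= 1 ->
  (forall x y, 0 <= b x y) -> (forall x, \sum_y b x y <= 1) -> (forall y, \sum_x b x y <= 1) ->
  expectation q (fun A => expectation r (fun B =>
    expR (- \sum_(x in A) \sum_(y in B) b x y))) <= expR (- (q * r / 4 * \sum_x \sum_y b x y)).
Proof.
move=> q01 r01 b0 row col; have /andP[r0 r1] := r01.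
apply: (@le_trans _ _ (expectation q (fun A => expR (- \sum_(x in A) (r / 2 * \sum_y b x y))))).
  apply: expectation_le => // A.
  have -> : \sum_(x in A) (r / 2 * \sum_y b x y) = r / 2 * \sum_y \sum_(x in A) b x y.
    by rewrite -mulr_sumr exchange_big.
  under [X in expectation r X]eq_fun do rewrite exchange_big.
  apply: linear_laplace_le => // y; rewrite sumr_ge0 //=; apply: le_trans (col y).
  by rewrite [X in _ <= X](bigID (mem A)) /= lerDl sumr_ge0.
apply: le_trans (linear_laplace_le _ _) _ => //.
  move=> x; have S0 : 0 <= \sum_y b x y by apply: sumr_ge0.
  rewrite mulr_ge0 ?divr_ge0 //=.
  (* [r / 2] times a row sum is at most one, as the second round requires *)
  have := ler_pM r0 S0 r1 (row x); lra.
by rewrite -mulr_sumr ler_expR; lra.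
Qed.

Lemma expR_sub1_le (l : R) : l <= 1 / 2 -> expR l - 1 <= l + 2 * l ^+ 2.
Proof.
move=> l2; have h := expR_ge1Dx (- l); have := expRxMexpNx_1 l.
have := expR_gt0 l => e0 e1; have := ler_wpM2l (ltW e0) h; rewrite e1 => h1.
have l0 : 0 < 1 - l by lra.
rewrite -(ler_pM2r l0).
have := mulr_ge0 (sqr_ge0 l) (_ : 0 <= 1 - 2 * l); rewrite subr_ge0.
have h3 : 2 * l <= 1 by lra.
move=> /(_ h3); rewrite expr2; lra.
Qed.

Lemma expectation_exp_card p (N : {set T}) (l : R) : 0 <= p <= 1 ->
  expectation p (fun W => expR (l * #|N :&: W|%:R)) <= expR (p * #|N|%:R * (expR l - 1)).
Proof.
move=> /andP[p0 p1].
have -> : expectation p (fun W => expR (l * #|N :&: W|%:R)) =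
    expectation p (fun W => expR (\sum_(x in W) if x \in N then l else 0)).
  apply: eq_bigr => W _; congr (_ * expR _); rewrite -big_mkcondr sumr_const /=.
  by rewrite mulr_natr; congr (_ *+ _); apply: eq_card => x; rewrite inE andbC.
rewrite expectation_exp.
have -> : p * #|N|%:R * (expR l - 1) = \sum_x (if x \in N then p * (expR l - 1) else 0).
  by rewrite -big_mkcond sumr_const /= -[RHS]mulr_natr; ring.
rewrite expR_sum; apply: ler_prod => x _; have el := expR_ge0 l.
case: ifP => _; last by rewrite !expR0; lra.
rewrite addr_ge0 ?mulr_ge0 ?subr_ge0 //=; apply: le_trans (expR_ge1Dx _); lra.
Qed.

(** Both tails at once: a negative [l] gives the lower tail.  The bounds below
    take [l = eta / 4] and [l = - eta / 4]. *)
Lemma chernoff_exp p (N : {set T}) (l t : R) : 0 <= p <= 1 -> l <= 1 / 2 ->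
  expectation p (fun W => (l * t < l * #|N :&: W|%:R)%R%:R) <=
  expR (p * #|N|%:R * (l + 2 * l ^+ 2) - l * t).
Proof.
move=> p01 l2; have /andP[p0 p1] := p01.
apply: (@le_trans _ _ (expectation p (fun W => expR (- (l * t)) * expR (l * #|N :&: W|%:R)))).
  apply: expectation_le => // W; case: ltP => h; last by rewrite mulr_ge0 ?expR_ge0.
  rewrite -expRD -[leLHS]/(1 : R); apply: le_trans (expR_ge1Dx _); rewrite lerDl.
  by move: h; move: (_ * _%:R) (l * t) => u v h; lra.
rewrite expectationZ expRD mulrC ler_wpM2r ?expR_ge0 //.
apply: le_trans (expectation_exp_card _ _ p01) _.
by rewrite ler_expR ler_wpM2l ?mulr_ge0 // expR_sub1_le.
Qed.

Lemma chernoff_upper p (N : {set T}) (eta : R) : 0 <= p <= 1 -> 0 < eta <= 1 ->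
  expectation p (fun W => ((1 + eta) * (p * #|N|%:R) < #|N :&: W|%:R)%R%:R) <=
  expR (- (eta ^+ 2 / 8 * (p * #|N|%:R))).
Proof.
move=> p01 /andP[eta0 eta1].
have e4 : 0 < eta / 4 by lra.
apply: le_trans (le_trans _ (@chernoff_exp _ N (eta / 4) ((1 + eta) * (p * #|N|%:R)) p01 _)) _.
- by apply: expectation_le => // W; rewrite (ltr_pM2l e4).
- by lra.
- by rewrite ler_expR; move: (#|N|%:R : R) => m; rewrite !expr2; lra.
Qed.

Lemma chernoff_lower p (N : {set T}) (eta : R) : 0 <= p <= 1 -> 0 < eta <= 1 ->
  expectation p (fun W => (#|N :&: W|%:R < (1 - eta) * (p * #|N|%:R))%R%:R) <=
  expR (- (eta ^+ 2 / 8 * (p * #|N|%:R))).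
Proof.
move=> p01 /andP[eta0 eta1].
have e4 : - (eta / 4) < 0 by lra.
apply: le_trans (le_trans _ (@chernoff_exp _ N (- (eta / 4)) ((1 - eta) * (p * #|N|%:R)) p01 _)) _.
- by apply: expectation_le => // W; rewrite (ltr_nM2l e4).
- by lra.
- by rewrite ler_expR; move: (#|N|%:R : R) => m; rewrite !expr2; lra.
Qed.
End RandomSubset.

(** * Counting colourings of small cut weight *)

(** Partitions of [T] are represented by functions [T -> T], the classes being
    the fibres; [coarsens h g] holds when each class of [h] lies in a class of
    [g]. *)
Definition coarsens (T : finType) (h g : T -> T) : bool :=
  [forall x, forall y, (h x == h y) ==> (g x == g y)].

Lemma coarsensP (T : finType) (h g : T -> T) :
  reflect (forall x y, h x = h y -> g x = g y) (coarsens h g).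
Proof.
apply: (iffP forallP) => [H x y /eqP hxy | H x].
  by move/forallP/(_ y)/implyP/(_ hxy)/eqP: (H x).
by apply/forallP => y; apply/implyP => /eqP /H ->.
Qed.

Definition cut_weight (R : numDomainType) (T : finType) (F : T -> T -> R)
    (h : T -> T) : R :=
  \sum_x \sum_(y | h x != h y) F x y.

Definition color_count (T : finType) (h : T -> T) : nat := #|[set h x | x : T]|.

Definition merge_colors (T : finType) (h : T -> T) (i j : T) (x : T) : T :=
  if h x == h j then h i else h x.

Lemma merge_color_count (T : finType) (h : T -> T) (i j : T) :
  h i != h j -> (color_count (merge_colors h i j)).+1 = color_count h.
Proof.
move=> hij; rewrite /color_count (cardsD1 (h j) [set h x | x : T]) imset_f //=.
rewrite add1n; congr _.+1; apply: eq_card => z; rewrite !inE.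
apply/imsetP/andP => [[x _ ->]|[zj /imsetP[x _ zx]]].
  by rewrite /merge_colors; case: ifP => [_|/negbT ne]; split=> //; apply: imset_f.
by exists x => //; rewrite /merge_colors -zx (negPf zj).
Qed.

Lemma coarsens_merge (T : finType) (h g : T -> T) (i j : T) :
  coarsens h g -> g i = g j -> coarsens (merge_colors h i j) g.
Proof.
move=> /coarsensP hg gij; apply/coarsensP => x y; rewrite /merge_colors.
case: eqP => [/hg ->|_]; case: eqP => [/hg ->|_] //; last exact: hg.
  by move/hg => <-.
by move/hg => ->.
Qed.

Lemma coarsens_trans (T : finType) (h g k : T -> T) :
  coarsens h g -> coarsens g k -> coarsens h k.
Proof.
by move=> /coarsensP hg /coarsensP gk; apply/coarsensP => x y /hg /gk.
Qed.

Lemma merge_coarsens (T : finType) (h : T -> T) (i j : T) :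
  coarsens h (merge_colors h i j).
Proof. by apply/coarsensP => x y; rewrite /merge_colors => ->. Qed.

Lemma card_coarsens (T : finType) (h : T -> T) :
  (#|[set g : {ffun T -> T} | coarsens h g]| <= #|T| ^ color_count h)%N.
Proof.
pose I := [set h x | x : T].
pose rep (z : T) := odflt z [pick x | h x == z].
pose f (g : {ffun T -> T}) : {ffun {z | z \in I} -> T} := [ffun z => g (rep (val z))].
have -> : (#|T| ^ color_count h)%N = #|{ffun {z | z \in I} -> T}|.
  by rewrite card_ffun card_sig; congr (_ ^ _)%N; apply: eq_card => z; rewrite inE.
rewrite -(card_in_imset (f := f)); first exact: max_card.
move=> g1 g2; rewrite !inE => /coarsensP c1 /coarsensP c2 /ffunP e12.
apply/ffunP => x; have hx : h x \in I by apply: imset_f.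
have := e12 (exist (fun z => z \in I) (h x) hx); rewrite !ffunE /= /rep.
case: pickP => [y /eqP hy|/(_ x)]; last by rewrite eqxx.
by rewrite /= (c1 _ _ hy) (c2 _ _ hy).
Qed.

(** Karger's contraction argument.  Let [g] be a colouring of small cut weight,
    constant on the classes of [h].  Among the pairs separated by [h], chosen with
    probability proportional to their weight, only the fraction
    [cut_weight F g / cut_weight F h] is separated by [g].  Merging the two
    classes of a random pair therefore preserves [g] with probability at least
    [1 - a / k], where [k] is the number of classes of [h].  The induction below
    phrases this as a double count of pairs (colouring, preserved pair). *)
Section Counting.
Variables (R : realFieldType) (T : finType) (F : T -> T -> R).
Hypothesis F_ge0 : forall x y, 0 <= F x y.
Variables (lam : R) (a : nat) (h0 : T -> T).
Hypothesis lam_gt0 : 0 < lam.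
Hypothesis cut_ge : forall h : T -> T, coarsens h0 h -> (a < color_count h)%N ->
  (color_count h)%:R * lam <= cut_weight F h.

Definition light_colorings (h : T -> T) : {set {ffun T -> T}} :=
  [set g : {ffun T -> T} | coarsens h g && (cut_weight F g <= a%:R * lam)].

Lemma light_colorings_merge (h : T -> T) i j :
  [set g in light_colorings h | g i == g j] \subset light_colorings (merge_colors h i j).
Proof.
apply/subsetP => g; rewrite !inE => /andP[/andP[hg ->] /eqP gij].
by rewrite coarsens_merge.
Qed.

Lemma light_colorings_double_count (h : T -> T) :
  #|light_colorings h|%:R * (cut_weight F h - a%:R * lam) <=
  \sum_x \sum_(y | h x != h y) F x y * #|[set g in light_colorings h | g x == g y]|%:R.
Proof.
have -> : \sum_x \sum_(y | h x != h y) F x y * #|[set g in light_colorings h | g x == g y]|%:R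
   = \sum_(g in light_colorings h) \sum_x \sum_(y | h x != h y) F x y *+ (g x == g y).
  rewrite exchange_big /=; apply: eq_bigr => x _.
  rewrite exchange_big /=; apply: eq_bigr => y _.
  rewrite -sum1_card natr_sum mulr_sumr.
  rewrite [RHS](bigID (fun g : {ffun T -> T} => g x == g y)) /=.
  rewrite [X in _ + X]big1 ?addr0; last by move=> g /andP[_ /negPf ->].
  rewrite [LHS](eq_bigl (fun g : {ffun T -> T} => (g \in light_colorings h) && (g x == g y))).
    by apply: eq_bigr => g /andP[_ ->]; rewrite mulr1.
  by move=> g; rewrite !inE.
rewrite mulr_natl -sumr_const; apply: ler_sum => g; rewrite inE => /andP[hg gl].
rewrite lerBlDr; apply: le_trans (lerD (lexx _) gl).
rewrite /cut_weight -big_split /=; apply: ler_sum => x _.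
rewrite [X in X <= _](bigID (fun y => g x == g y)) /=.
apply: lerD.
  rewrite [X in _ <= X](bigID (fun y => g x == g y)) /= -[X in X <= _]addr0.
  apply: lerD; last by apply: sumr_ge0 => y _; rewrite mulrn_wge0.
  by apply: ler_sum => y /andP[_ ->].
rewrite [X in X <= _](_ : _ = \sum_(y | g x != g y) F x y) //.
apply: eq_bigl => y; apply/andP/idP => [[] //|gxy]; split => //.
by apply: contra gxy => /eqP /(coarsensP _ _ hg) /eqP.
Qed.

Hypothesis T_gt0 : (0 < #|T|)%N.

(** The factors [k / (k - a)] of the successive merges multiply up to a binomial
    coefficient; once [a] classes are left, all their colourings are counted. *)
Lemma count_light_colorings_rec (k : nat) : (a <= k)%N ->
  forall h, coarsens h0 h -> (color_count h <= k)%N ->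
  (#|light_colorings h| <= #|T| ^ a * 'C(k, a))%N.
Proof.
move=> ak; rewrite -(subnKC ak); elim: (k - a)%N => {k ak} [|m IH] h h0h hk.
  rewrite addn0 binn muln1; apply: leq_trans (leq_pexp2l T_gt0 (n2 := a) _).
    apply: leq_trans (card_coarsens h); apply: subset_leq_card.
    by apply/subsetP => g; rewrite !inE => /andP[].
  by rewrite addn0 in hk.
have [hk'|hk'] := leqP (color_count h) (a + m).
  apply: leq_trans (IH _ h0h hk') _.
  by rewrite leq_mul2l leq_bin2l ?orbT // addnS.
have {hk'}hk : color_count h = (a + m).+1 by lia.
rewrite -(ler_nat R).
set N := #|light_colorings h|; set b := (#|T| ^ a * 'C(a + m, a))%N.
have cut_h : (a + m).+1%:R * lam <= cut_weight F h.
  by rewrite -hk; apply: cut_ge => //; lia.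
have cut_gt0 : 0 < cut_weight F h by apply: lt_le_trans cut_h; rewrite mulr_gt0.
have Nb : N%:R * (cut_weight F h - a%:R * lam) <= cut_weight F h * b%:R.
  apply: le_trans (light_colorings_double_count h) _; rewrite /cut_weight mulr_suml.
  apply: ler_sum => x _; rewrite mulr_suml; apply: ler_sum => y hxy.
  rewrite ler_wpM2l // ler_nat; apply: leq_trans (subset_leq_card (light_colorings_merge h x y)) _.
  apply: IH; first by apply: coarsens_trans h0h _; apply: merge_coarsens.
  by have := merge_color_count hxy; lia.
have binE : (m.+1 * 'C(a + m.+1, a) = (a + m).+1 * 'C(a + m, a))%N.
  by have := mul_bin_down (a + m.+1) a; rewrite addnS /= => ->; congr (_ * _)%N; lia.
(* If [N > b] then [(N - b) * cut <= N * a * lam], and [cut] is at least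
   [(a + m + 1) * lam]. *)
have Nb' : N%:R * m.+1%:R <= (a + m).+1%:R * b%:R :> R.
  rewrite -addnS !natrD in cut_h *.
  have [Nb1|/ltW Nb1] := leP (N%:R : R) b%:R.
    by have := ler_wpM2r (ler0n R m.+1) Nb1; have := mulr_ge0 (ler0n R a) (ler0n R b); lra.
  rewrite -subr_ge0 in Nb1; have := ler_wpM2l Nb1 cut_h.
  move=> h1; suff: (N%:R - b%:R) * (a%:R + m.+1%:R) * lam <= N%:R * a%:R * lam :> R.
    by rewrite ler_pM2r //; lra.
  by lra.
rewrite -natrM -natrM ler_nat in Nb'.
rewrite ler_nat -(leq_pmul2l (ltn0Sn m)) mulnC; apply: leq_trans Nb' _.
rewrite mulnCA binE; by rewrite /b mulnCA.
Qed.

Lemma bin_le_exp n m : ('C(n, m) <= n ^ m)%N.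
Proof.
apply: (@leq_trans (n ^_ m)); first by rewrite -bin_ffact leq_pmulr ?fact_gt0.
elim: m => // m IH; rewrite ffactnSr expnSr leq_mul //; lia.
Qed.

Lemma count_light_colorings : (#|light_colorings h0| <= #|T| ^ (2 * a))%N.
Proof.
have h0h0 : coarsens h0 h0 by apply/coarsensP.
have h0T : (color_count h0 <= #|T|)%N by apply: max_card.
rewrite mul2n -addnn expnD; have [aT|Ta] := leqP a #|T|.
  apply: leq_trans (count_light_colorings_rec aT h0h0 h0T) _.
  by rewrite leq_mul2l bin_le_exp orbT.
have := count_light_colorings_rec (leqnn a) h0h0 (leq_trans h0T (ltnW Ta)).
rewrite binn muln1 => /leq_trans -> //.
by rewrite leq_pmulr // expn_gt0 T_gt0.
Qed.
End Counting.

(** * A spreading edge weight on vertex-transitive graphs *)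

(** The probability that two independent events of probabilities [a] and [b]
    disagree.  Sets of vertices are replaced by functions to [0, 1] throughout,
    and this is the contribution of an edge to the cut. *)
Definition mismatch (R : pzRingType) (a b : R) : R := a * (1 - b) + (1 - a) * b.

Section Mismatch.
Variable R : realFieldType.
Implicit Types a b c : R.

(** With an independent third event of probability [b] in between, a disagreement
    of the outer two forces a disagreement with the middle one. *)
Lemma mismatch_triangle a b c : 0 <= a <= 1 -> 0 <= b <= 1 -> 0 <= c <= 1 ->
  mismatch a c <= mismatch a b + mismatch b c.
Proof.
move=> /andP[a0 a1] /andP[b0 b1] /andP[c0 c1]; rewrite -subr_ge0.
have -> : mismatch a b + mismatch b c - mismatch a c =
  (b * ((1 - a) * (1 - c)) + a * c * (1 - b)) *+ 2 by rewrite /mismatch; ring.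
by rewrite mulrn_wge0 // addr_ge0 // !mulr_ge0 ?subr_ge0.
Qed.

Lemma mismatch_ge0 a b : 0 <= a <= 1 -> 0 <= b <= 1 -> 0 <= mismatch a b.
Proof.
by move=> /andP[a0 a1] /andP[b0 b1]; rewrite addr_ge0 // mulr_ge0 ?subr_ge0.
Qed.

Lemma mismatch_sub a b : 0 <= a <= 1 -> 0 <= b <= 1 -> b <= a + mismatch a b.
Proof.
move=> /andP[a0 a1] /andP[b0 b1]; rewrite -subr_ge0.
have -> : a + mismatch a b - b = (a * (1 - b)) *+ 2 by rewrite /mismatch; ring.
by rewrite mulrn_wge0 // mulr_ge0 ?subr_ge0.
Qed.

Definition steps (T : Type) (x : T) (p : seq T) : seq (T * T) := zip (x :: p) p.

Variables (T : eqType) (f : T -> R).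
Hypothesis f01 : forall v, 0 <= f v <= 1.

Let S x p := \sum_(st <- steps x p) mismatch (f st.1) (f st.2).

Lemma walk_mismatch_cons x y p : S x (y :: p) = mismatch (f x) (f y) + S y p.
Proof. by rewrite /S /steps /= big_cons. Qed.

Lemma walk_mismatch_ge0 x p : 0 <= S x p.
Proof. by apply: sumr_ge0 => st _; apply: mismatch_ge0. Qed.

Lemma walk_mismatch_ends x p : p != [::] -> mismatch (f x) (f (last x p)) <= S x p.
Proof.
elim: p x => // y [|z p] IH x _.
  by rewrite walk_mismatch_cons /= lerDl walk_mismatch_ge0.
rewrite walk_mismatch_cons; apply: le_trans (mismatch_triangle (f01 x) (f01 y) (f01 _)) _.
by rewrite lerD2l; apply: (IH y).
Qed.

Lemma walk_mismatch_max x p v : v \in x :: p -> f v <= f x + S x p.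
Proof.
elim: p x => [|y p IH] x.
  by rewrite inE => /eqP ->; rewrite lerDl walk_mismatch_ge0.
rewrite inE => /orP[/eqP ->|/IH h]; first by rewrite lerDl walk_mismatch_ge0.
rewrite walk_mismatch_cons; apply: le_trans h _.
by rewrite addrA lerD2r mismatch_sub.
Qed.
End Mismatch.

Definition geodesic (T : finType) (e : rel T) (x : T) (p : seq T) : Prop :=
  path e x p /\ forall q, path e x q -> last x q = last x p -> (size p <= size q)%N.

Lemma geodesic_exists (T : finType) (e : rel T) : graph_connected e ->
  exists G : T -> T -> seq T, forall x y, geodesic e x (G x y) /\ last x (G x y) = y.
Proof.
move=> conn.
suff H x y : exists p, geodesic e x p /\ last x p = y.
  exists (fun x y => projT1 (cid (H x y))) => x y; exact: (projT2 (cid (H x y))).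
have /connectP[p0 pth0 y0] := conn x y.
pose P n := `[< exists p, [/\ path e x p, last x p = y & size p = n] >].
have exP : exists n, P n by exists (size p0); apply/asboolP; exists p0.
case: (ex_minnP exP) => n /asboolP[p [pp lp sp]] nmin; exists p; split=> //.
by split=> // q qp lq; rewrite sp; apply: nmin; apply/asboolP; exists q; rewrite lq lp.
Qed.

Definition is_aut (T : finType) (e : rel T) (s : {perm T}) : bool :=
  [forall x, forall y, e (s x) (s y) == e x y].

Lemma is_autP (T : finType) (e : rel T) (s : {perm T}) :
  reflect (automorphism e s) (is_aut e s).
Proof.
apply: (iffP forallP) => [H x y|H x].
  by move/forallP/(_ y)/eqP: (H x).
by apply/forallP => y; rewrite H.
Qed.

Definition auts (T : finType) (e : rel T) : {set {perm T}} := [set s | is_aut e s].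

Lemma autsP (T : finType) (e : rel T) (s : {perm T}) :
  reflect (automorphism e s) (s \in auts e).
Proof. by rewrite inE; apply: is_autP. Qed.

Lemma aut_geodesic (T : finType) (e : rel T) (s : {perm T}) x p :
  automorphism e s -> geodesic e x p -> geodesic e (s x) (map s p).
Proof.
move=> aut [pp pmin].
have spath y q : path e (s y) (map s q) = path e y q.
  by elim: q y => //= z q IH y; rewrite aut IH.
split; first by rewrite spath.
move=> q; have -> : q = map s (map (s^-1)%g q).
  by rewrite -map_comp -[LHS]map_id; apply: eq_map => z /=; rewrite permKV.
by rewrite spath !last_map => qp /perm_inj lq; rewrite !(size_map s); apply: pmin.
Qed.

Section Average.
Variables (R : realFieldType) (T : finType) (e : rel T).
Hypothesis e_vt : vertex_transitive e.

Lemma auts_gt0 : (0 < #|auts e|)%N.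
Proof. by apply/card_gt0P; exists 1%g; apply/autsP => x y; rewrite !perm1. Qed.

(** A random automorphism maps a given vertex to a uniformly distributed one. *)
Lemma sum_auts (F : T -> R) (a : T) :
  \sum_(s in auts e) F (s a) = #|auts e|%:R / #|T|%:R * \sum_b F b.
Proof.
have T0 : (#|T|%:R : R) != 0 by rewrite pnatr_eq0 -lt0n; apply/card_gt0P; exists a.
pose N b := #|[set s in auts e | s a == b]|.
have Nconst b b' : N b = N b'.
  have [t taut tb] := e_vt b b'.
  rewrite /N -(card_imset _ (@mulIg _ t)); apply: eq_card => s; rewrite !inE.
  apply/imsetP/andP => [[s'] | [/is_autP saut /eqP sa]].
    rewrite !inE => /andP[/is_autP saut /eqP sb] ->; split; last by rewrite permM sb tb.
    by apply/is_autP => x y; rewrite !permM taut saut.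
  exists (s * t^-1)%g; last by rewrite mulgKV.
  rewrite !inE; apply/andP; split; last by rewrite permM sa -tb permK.
  by apply/is_autP => x y; rewrite !permM -[LHS]taut !permKV saut.
have Na : \sum_b (N b)%:R = #|auts e|%:R :> R.
  rewrite -natr_sum; congr _%:R; rewrite -sum1_card.
  rewrite (partition_big (fun s : {perm T} => s a) predT) //=.
  by apply: eq_bigr => b _; rewrite /N -sum1_card; apply: eq_bigl => s; rewrite inE.
have Nb b : (N b)%:R = #|auts e|%:R / #|T|%:R :> R.
  rewrite -Na (eq_bigr (fun=> (N b)%:R)); last by move=> b' _; rewrite (Nconst b' b).
  by rewrite sumr_const -[_ *+ #|_|]mulr_natr mulfK.
rewrite (partition_big (fun s : {perm T} => s a) predT) //= mulr_sumr.
apply: eq_bigr => b _; rewrite -(Nb b) /N.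
rewrite (eq_bigr (fun=> F b)); last by move=> s /andP[_ /eqP ->].
rewrite sumr_const mulr_natl; congr (_ *+ _); apply: eq_card => s; rewrite !inE.
by rewrite unfold_in inE.
Qed.
End Average.

Section Weights.
Variables (R : realFieldType) (T : finType) (e : rel T).
Hypothesis e_vt : vertex_transitive e.
Hypothesis T_ge4 : (4 <= #|T|)%N.

Variable geo : T -> T -> seq T.
Hypothesis geoP : forall x y, geodesic e x (geo x y).
Hypothesis geo_last : forall x y, last x (geo x y) = y.

(** Expected traffic: [G] is summed along the automorphic images of all the
    chosen shortest paths. *)
Definition geo_sum (G : T -> T -> R) : R :=
  \sum_(s in auts e) \sum_x \sum_(y | y != x) \sum_(st <- steps x (geo x y))
    G (s st.1) (s st.2).

Definition total_length : R := \sum_x \sum_(y | y != x) (size (geo x y))%:R.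

Definition geo_weight (u v : T) : R :=
  #|T|%:R / (#|auts e|%:R * total_length) * geo_sum (fun a b => ((a == u) && (b == v))%:R).

Let n : R := #|T|%:R.
Let A : R := #|auts e|%:R.

Lemma geo_nil x y : y != x -> geo x y != [::].
Proof.
move=> yx; apply/eqP => g0; have := geo_last x y.
by rewrite g0 /= => /eqP; rewrite eq_sym (negPf yx).
Qed.

Lemma order_ge4 : 4 <= n. Proof. by rewrite ler_nat. Qed.
Lemma order_gt0 : 0 < n. Proof. by rewrite ltr0n (leq_trans _ T_ge4). Qed.
Lemma auts_order_gt0 : 0 < A. Proof. by rewrite ltr0n auts_gt0. Qed.

Lemma total_length_gt0 : 0 < total_length.
Proof.
have /card_gt1P[x [y [_ _ xy]]] : (1 < #|T|)%N by apply: leq_trans T_ge4.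
rewrite /total_length (bigD1 x) //=; apply: ltr_wpDr.
  by apply: sumr_ge0 => z _; apply: sumr_ge0.
rewrite (bigD1 y) /=; last by rewrite eq_sym.
apply: ltr_wpDr; first by apply: sumr_ge0.
by rewrite ltr0n lt0n size_eq0 geo_nil // eq_sym.
Qed.

Lemma geo_weight_ge0 u v : 0 <= geo_weight u v.
Proof.
rewrite mulr_ge0 ?divr_ge0 ?mulr_ge0 ?(ltW total_length_gt0) //.
by do !(apply: sumr_ge0 => ? _).
Qed.

Lemma sum_geo_weight (G : T -> T -> R) :
  \sum_u \sum_v geo_weight u v * G u v = n / (A * total_length) * geo_sum G.
Proof.
pose H u v := geo_sum (fun a b => ((a == u) && (b == v))%:R).
transitivity (n / (A * total_length) * \sum_u \sum_v H u v * G u v).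
  rewrite mulr_sumr; apply: eq_bigr => u _; rewrite mulr_sumr; apply: eq_bigr => v _.
  by rewrite mulrA.
congr (_ * _); rewrite /H /geo_sum.
under eq_bigr do under eq_bigr do rewrite mulr_suml.
under eq_bigr do rewrite exchange_big.
rewrite exchange_big /=; apply: eq_bigr => s _.
under eq_bigr do under eq_bigr do rewrite mulr_suml.
under eq_bigr do rewrite exchange_big.
rewrite exchange_big /=; apply: eq_bigr => x _.
under eq_bigr do under eq_bigr do rewrite mulr_suml.
under eq_bigr do rewrite exchange_big.
rewrite exchange_big /=; apply: eq_bigr => y _.
under eq_bigr do under eq_bigr do rewrite mulr_suml.
under eq_bigr do rewrite exchange_big.
rewrite exchange_big /=; apply: eq_bigr => st _.
rewrite (bigD1 (s st.1)) //= (bigD1 (s st.2)) //= !eqxx mul1r.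
rewrite big1 ?addr0; last by move=> v /negPf; rewrite eq_sym => ->; rewrite mul0r.
rewrite big1 ?addr0 // => u /negPf; rewrite eq_sym => ->.
by rewrite big1 // => v _; rewrite mul0r.
Qed.

Lemma geo_weight_edge u v : geo_weight u v != 0 -> e u v.
Proof.
apply: contraR => neuv; apply/eqP; rewrite /geo_weight /geo_sum.
rewrite big1 ?mulr0 // => s /autsP saut; rewrite big1 // => x _; rewrite big1 // => y _.
rewrite big_seq; move: (proj1 (geoP x y)); move: (geo x y) => p; elim: p x => [|z p IH] x /=.
  by rewrite big1.
move=> /andP[exz pz]; rewrite -big_seq /steps /= big_cons /= -/(steps z p).
rewrite big_seq IH // addr0; case: eqP => //= su; case: eqP => //= sv.
by move: neuv; rewrite -su -sv saut exz.
Qed.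

Lemma sum_geo_vertex (F : T -> R) (V : T -> T -> seq T) :
  \sum_(s in auts e) \sum_x \sum_(y | y != x) \sum_(v <- V x y) F (s v) =
  A / n * (\sum_b F b) * \sum_x \sum_(y | y != x) (size (V x y))%:R.
Proof.
rewrite exchange_big mulr_sumr; apply: eq_bigr => x _ /=.
rewrite exchange_big mulr_sumr; apply: eq_bigr => y _ /=.
rewrite exchange_big /=.
under eq_bigr do rewrite (sum_auts e_vt).
by rewrite big_const_seq count_predT iter_addr_0 -[LHS]mulr_natr.
Qed.

Lemma size_steps (x : T) (p : seq T) : size (steps x p) = size p.
Proof. by rewrite size_zip /=; apply/minn_idPr. Qed.

Lemma geo_weight_row u : \sum_v geo_weight u v = 1.
Proof.
have -> : \sum_v geo_weight u v = \sum_a \sum_b geo_weight a b * (a == u)%:R.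
  rewrite [RHS](bigD1 u) //= eqxx; under [X in _ = X + _]eq_bigr do rewrite mulr1.
  by rewrite [X in _ + X]big1 ?addr0 // => a /negPf ->; rewrite big1 // => b _; rewrite mulr0.
rewrite sum_geo_weight.
have -> : geo_sum (fun a b => (a == u)%:R) =
    A / n * (\sum_b (b == u)%:R) * total_length.
  transitivity (\sum_(s in auts e) \sum_x \sum_(y | y != x)
      \sum_(z <- unzip1 (steps x (geo x y))) (s z == u)%:R : R).
    by do 3 (apply: eq_bigr => ? _); rewrite big_map.
  rewrite (sum_geo_vertex (fun z => (z == u)%:R)); congr (_ * _).
  by do 2 (apply: eq_bigr => ? _); rewrite size_map size_steps.
rewrite (bigD1 u) //= eqxx big1 ?addr0; last by move=> a /negPf ->.
have := order_gt0; have := auts_order_gt0; have := total_length_gt0; rewrite /= mulr1.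
move: (total_length) (A) (n) => l c m l0 c0 m0.
by field; rewrite !gt_eqF.
Qed.

Lemma geo_weight_col v : \sum_u geo_weight u v = 1.
Proof.
have -> : \sum_u geo_weight u v = \sum_a \sum_b geo_weight a b * (b == v)%:R.
  apply: eq_bigr => a _; rewrite (bigD1 v) //= eqxx mulr1 big1 ?addr0 // => b /negPf ->.
  by rewrite mulr0.
rewrite sum_geo_weight.
have -> : geo_sum (fun a b => (b == v)%:R) =
    A / n * (\sum_b (b == v)%:R) * total_length.
  transitivity (\sum_(s in auts e) \sum_x \sum_(y | y != x)
      \sum_(z <- unzip2 (steps x (geo x y))) (s z == v)%:R : R).
    by do 3 (apply: eq_bigr => ? _); rewrite big_map.
  rewrite (sum_geo_vertex (fun z => (z == v)%:R)); congr (_ * _).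
  by do 2 (apply: eq_bigr => ? _); rewrite size_map size_steps.
rewrite (bigD1 v) //= eqxx big1 ?addr0; last by move=> a /negPf ->.
have := order_gt0; have := auts_order_gt0; have := total_length_gt0; rewrite /= mulr1.
move: (total_length) (A) (n) => l c m l0 c0 m0.
by field; rewrite !gt_eqF.
Qed.

(** Here [f] is the indicator of a set smeared over the graph, and [g <= f] is the
    part of it that a shortest path can meet only rarely.  The two lower bounds on
    the cut [D] behave oppositely in the ratio of the mass [a] to the mean length
    [L / n^2] of a path, and a fixed combination of them does not depend on this
    ratio. *)
Section Isoperimetry.
Variables (f g : T -> R) (kap M : R).
Hypothesis g_ge0 : forall v, 0 <= g v.
Hypothesis g_le_f : forall v, g v <= f v.
Hypothesis f_le1 : forall v, f v <= 1.
Let a := \sum_v f v.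
Hypothesis a_gt0 : 0 < a.
Hypothesis a_half : a <= n / 2.
Hypothesis kap_ge0 : 0 <= kap.
Hypothesis kap_le : kap * a <= \sum_v g v.
Hypothesis M_gt0 : 0 < M.
Hypothesis supp_le : forall x p, geodesic e x p ->
  (count (fun v => 0 < g v) (x :: p))%:R <= M * a.

Let D := \sum_u \sum_v geo_weight u v * mismatch (f u) (f v).
Let L := total_length.

Lemma spread_fun01 v : 0 <= f v <= 1.
Proof. by rewrite f_le1 andbT (le_trans (g_ge0 v)). Qed.

Lemma geo_sum_mismatch : geo_sum (fun u v => mismatch (f u) (f v)) = D * (A * L / n).
Proof.
rewrite /D sum_geo_weight.
have := order_gt0; have := auts_order_gt0; have := total_length_gt0; rewrite -/L.
move: L A n D => l c m D' l0 c0 m0; by field; rewrite !gt_eqF.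
Qed.

Lemma sum_pairs_aut (s : {perm T}) (G : T -> T -> R) :
  \sum_x \sum_(y | y != x) G (s x) (s y) = \sum_x \sum_(y | y != x) G x y.
Proof.
rewrite [RHS](reindex_inj (@perm_inj _ s)) /=; apply: eq_bigr => x _.
rewrite [RHS](reindex_inj (@perm_inj _ s)) /=; apply: eq_bigl => y.
by rewrite (inj_eq perm_inj).
Qed.

(** A path with independent uniform ends has its ends on different sides with
    probability of order [a / n]. *)
Lemma crossing_of_distant_ends : a * n ^+ 2 <= 2 * L * D.
Proof.
have pairs : a * n / 2 <= \sum_x \sum_(y | y != x) mismatch (f x) (f y).
  have -> : \sum_x \sum_(y | y != x) mismatch (f x) (f y) =
     \sum_x \sum_y mismatch (f x) (f y) - \sum_x mismatch (f x) (f x).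
    rewrite -sumrB; apply: eq_bigr => x _.
    by rewrite [X in _ = X - _](bigD1 x) //= addrAC subrr add0r.
  have -> : \sum_x \sum_y mismatch (f x) (f y) = 2 * a * (n - a).
    rewrite /mismatch; under eq_bigr do rewrite big_split /= -mulr_sumr -mulr_sumr.
    rewrite big_split /= -!mulr_suml !sumrB sumr_const -/a.
    by rewrite -[X in X *+ _]/(1:R) -/(n) /n; ring.
  have : \sum_x mismatch (f x) (f x) <= 2 * a.
    rewrite /a mulr_sumr; apply: ler_sum => x _; rewrite /mismatch.
    by have /andP[h1 h2] := spread_fun01 x; have := mulr_ge0 h1 h1; lra.
  have := order_ge4; have := a_gt0; have := a_half => h1 h2 h3 h4.
  have : 0 <= a * (n - 2 * a) by rewrite mulr_ge0 //; lra.
  (* four vertices suffice to absorb the diagonal terms *)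
  have : 0 <= a * (n - 4) by rewrite mulr_ge0 //; lra.
  by lra.
have : A * (a * n / 2) <= D * (A * L / n).
  rewrite -geo_sum_mismatch /geo_sum.
  apply: (@le_trans _ _ (\sum_(s in auts e) \sum_x \sum_(y | y != x) mismatch (f (s x)) (f (s y)))).
    under eq_bigr do rewrite (sum_pairs_aut _ (fun u v => mismatch (f u) (f v))).
    by rewrite sumr_const -[_ *+ #|_|]mulr_natl ler_wpM2l.
  apply: ler_sum => s _; apply: ler_sum => x _; apply: ler_sum => y yx.
  have := @walk_mismatch_ends R T (f \o s) (fun v => spread_fun01 (s v)) x (geo x y) (geo_nil yx).
  by rewrite geo_last.
have := order_gt0; have := auts_order_gt0; have := total_length_gt0; rewrite -/L => L0 A0 n0.
rewrite -subr_ge0.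
have -> : D * (A * L / n) - A * (a * n / 2) = (2 * L * D - a * n ^+ 2) * (A / (2 * n)).
  by field; rewrite !gt_eqF.
by rewrite pmulr_lge0 ?subr_ge0 // divr_gt0 // mulr_gt0.
Qed.

(** Along a path, every value of [f] is at most the value at the starting vertex
    plus the total mismatch.  Summing over the few vertices with [g > 0], the left
    side is the expected time spent in [g]; on the right, the starting vertices
    contribute only [a / n] per path. *)
Lemma crossing_of_short_visits : kap * L <= M * (n ^+ 2 * a + L * D).
Proof.
have kap_n := order_gt0; have A0 := auts_order_gt0; have L0 : 0 < L := total_length_gt0.
have h : A / n * (kap * a) * L <= M * a * (A * (n * a) + D * (A * L / n)).
  apply: (@le_trans _ _ (A / n * (\sum_b g b) * \sum_x \sum_(y | y != x) (size (x :: geo x y))%:R)).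
    apply: ler_pM; rewrite ?(ltW L0) //.
    - by rewrite mulr_ge0 ?divr_ge0 ?(ltW A0) ?(ltW kap_n) // mulr_ge0 // ltW.
    - by apply: ler_wpM2l => //; rewrite divr_ge0 ?ltW.
    - by apply: ler_sum => x _; apply: ler_sum => y _; rewrite ler_nat /=.
  rewrite -(sum_geo_vertex g (fun x y => x :: geo x y)) -geo_sum_mismatch.
  apply: (@le_trans _ _ (M * a * (\sum_(s in auts e) \sum_x \sum_(y | y != x)
      (f (s x) + \sum_(st <- steps x (geo x y)) mismatch (f (s st.1)) (f (s st.2)))))).
    rewrite mulr_sumr; apply: ler_sum => s saut; rewrite mulr_sumr; apply: ler_sum => x _.
    rewrite mulr_sumr; apply: ler_sum => y _.
    set B := f (s x) + _.
    have fB v : v \in x :: geo x y -> f (s v) <= B.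
      exact: (@walk_mismatch_max R T (f \o s) (fun v => spread_fun01 (s v))).
    have B0 : 0 <= B by apply: le_trans (fB x (mem_head _ _)); case/andP: (spread_fun01 (s x)).
    apply: (@le_trans _ _ (\sum_(v <- x :: geo x y) ((0 < g (s v))%R%:R * B) : R)).
      rewrite big_seq [X in _ <= X]big_seq; apply: ler_sum => v vp.
      case: ltP => [_|/le_trans -> //]; last by rewrite mul0r.
      by rewrite mul1r (le_trans (g_le_f _)) // fB.
    rewrite -mulr_suml ler_wpM2r // -natr_sum.
    have /autsP saut' := saut; have := supp_le (aut_geodesic saut' (geoP x y)).
    by rewrite -map_cons count_map -sum1_count big_mkcond.
  rewrite ler_wpM2l ?(ltW (mulr_gt0 M_gt0 a_gt0)) // /geo_sum.
  under eq_bigr do under eq_bigr do rewrite big_split /=.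
  under eq_bigr do rewrite big_split /=.
  rewrite big_split /= lerD2r.
  under eq_bigr do rewrite (sum_pairs_aut _ (fun u v => f u)).
  rewrite sumr_const -[_ *+ #|_|]mulr_natl ler_wpM2l // /a mulr_sumr; apply: ler_sum => x _.
  rewrite sumr_const -[_ *+ #|_|]mulr_natl ler_wpM2r ?ler_nat ?max_card //; by case/andP: (spread_fun01 x).
rewrite -subr_ge0.
have : 0 <= M * a * (A * (n * a) + D * (A * L / n)) - A / n * (kap * a) * L by rewrite subr_ge0.
have -> : M * a * (A * (n * a) + D * (A * L / n)) - A / n * (kap * a) * L =
  (M * (n ^+ 2 * a + L * D) - kap * L) * (A * a / n).
  by field; rewrite !gt_eqF.
by rewrite pmulr_lge0 // divr_gt0 // mulr_gt0.
Qed.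

Lemma geo_isoperimetry : kap / (3 * M) <= D.
Proof.
have L0 : 0 < L := total_length_gt0.
have h1 := crossing_of_distant_ends; have h2 := crossing_of_short_visits.
have : kap * L <= M * (3 * L * D).
  by apply: le_trans h2 _; rewrite ler_wpM2l ?(ltW M_gt0) //; lra.
rewrite ler_pdivrMr ?mulr_gt0 // => h3.
have : kap * L <= (D * (3 * M)) * L by lra.
by rewrite ler_pM2r.
Qed.
End Isoperimetry.
End Weights.

(** The only property of the edge weight used later, apart from its vertex sums
    and its support; [kap] and [M] will be [1 / 8] and [40 / d]. *)
Definition spreading (R : realFieldType) (T : finType) (e : rel T) (w : T -> T -> R) : Prop :=
  forall (f g : T -> R) (kap M : R),
    (forall v, 0 <= g v) -> (forall v, g v <= f v) -> (forall v, f v <= 1) ->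
    0 < \sum_v f v -> \sum_v f v <= #|T|%:R / 2 ->
    0 <= kap -> kap * (\sum_v f v) <= \sum_v g v -> 0 < M ->
    (forall x p, geodesic e x p ->
      (count (fun v => 0 < g v) (x :: p))%:R <= M * \sum_v f v) ->
    kap / (3 * M) <= \sum_u \sum_v w u v * mismatch (f u) (f v).

Lemma spreading_weight_exists (R : realFieldType) (T : finType) (e : rel T) :
  graph_connected e -> vertex_transitive e -> (4 <= #|T|)%N ->
  exists w : T -> T -> R,
  [/\ forall u v, 0 <= w u v, forall u v, w u v != 0 -> e u v,
      forall u, \sum_v w u v = 1, forall v, \sum_u w u v = 1 & spreading e w].
Proof.
move=> conn vt T4; have [geo geoP] := geodesic_exists conn.
have geo1 x y : geodesic e x (geo x y) := proj1 (geoP x y).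
have geo2 x y : last x (geo x y) = y := proj2 (geoP x y).
exists (geo_weight R e geo); split.
- exact: geo_weight_ge0.
- exact: geo_weight_edge.
- exact: geo_weight_row.
- exact: geo_weight_col.
- move=> f g kap M *; exact: (@geo_isoperimetry _ _ _ vt T4 geo geo1 geo2 f g).
Qed.

(** * Dense sets are visited rarely by geodesics *)

Definition nbhd (T : finType) (e : rel T) (v : T) : {set T} := [set y | e v y].

Lemma geodesic_shortcut (T : finType) (e : rel T) x p i j q :
  geodesic e x p -> (i <= j <= size p)%N ->
  path e (nth x (x :: p) i) q -> last (nth x (x :: p) i) q = nth x (x :: p) j ->
  (j <= i + size q)%N.
Proof.
move=> [pp pmin] /andP[ij jp].
have lt_ k : (k <= size p)%N -> last x (take k p) = nth x (x :: p) k.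
  case: k => [|k] kp; first by rewrite take0.
  by rewrite (last_nth x) size_takel //= nth_take.
have ip := leq_trans ij jp.
rewrite -!lt_ // => qp ql.
have := pmin (take i p ++ q ++ drop j p).
have pk k : path e x (take k p) && path e (last x (take k p)) (drop k p).
  by rewrite -cat_path cat_take_drop.
have /andP[pi _] := pk i; have /andP[_ pj] := pk j.
rewrite !cat_path pi qp ql pj !last_cat ql => /(_ isT).
have -> : last (last x (take j p)) (drop j p) = last x p.
  by rewrite -last_cat cat_take_drop.
by move/(_ erefl); rewrite !size_cat size_takel // size_drop; lia.
Qed.

Section Deterministic.
Variables (R : realFieldType) (T : finType) (e : rel T).
Hypothesis e_sym : symmetric e.

Lemma edge_double_count (A B : {set T}) :
  (\sum_(u in A) #|nbhd e u :&: B| = \sum_(v in B) #|nbhd e v :&: A|)%N.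
Proof.
have E (X Y : {set T}) : (\sum_(u in X) #|nbhd e u :&: Y| =
    \sum_(u in X) \sum_(v in Y) e u v)%N.
  apply: eq_bigr => u _; rewrite -sum1_card big_mkcond [RHS]big_mkcond /=.
  by apply: eq_bigr => v _; rewrite !inE andbC; case: (v \in Y); case: (e u v).
rewrite !E exchange_big; apply: eq_bigr => u _; apply: eq_bigr => v _.
by rewrite e_sym.
Qed.

(** Applied to the positions, on a shortest path, of the vertices within distance
    two of a given vertex. *)
Lemma card_close_ord n (X : {set 'I_n}) :
  (forall i j, i \in X -> j \in X -> (i <= j)%N -> (j <= i + 4)%N) -> (#|X| <= 5)%N.
Proof.
move=> close; have [->|[i0 i0X]] := set_0Vmem X; first by rewrite cards0.
case: (arg_minnP (fun i : 'I_n => val i) i0X) => m mX mmin.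
rewrite -[leqRHS]card_ord -(card_in_imset (f := fun i : 'I_n => inord (i - m) : 'I_5)).
  exact: max_card.
move=> i j iX jX /(congr1 val) /=.
have := close _ _ mX iX (mmin _ iX); have := close _ _ mX jX (mmin _ jX).
have := mmin _ iX; have := mmin _ jX => /= h1 h2 h3 h4.
rewrite !inordK; try lia.
by move=> h; apply: val_inj => /=; lia.
Qed.

(** Attach to each counted vertex of the path a neighbour in [A], and to this the
    set of its neighbours in [B], of size at least [th].  A vertex of [B] lies in
    at most five of these sets, for it would otherwise shorten the path. *)
Lemma geodesic_packing (A B : {set T}) (th : R) x p : geodesic e x p ->
  (forall u, u \in A -> th <= #|nbhd e u :&: B|%:R) ->
  (count (fun v => [exists u in A, e v u]) (x :: p))%:R * th <= 5 * #|B|%:R.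
Proof.
move=> geo dense.
pose v (i : 'I_(size p).+1) := nth x (x :: p) i.
pose J := [set i | [exists u in A, e (v i) u]].
pose u i := odflt x [pick u in A | e (v i) u].
have uP i : i \in J -> (u i \in A) && e (v i) (u i).
  rewrite inE => /existsP[z zP]; rewrite /u; case: pickP => [y //|/(_ z)].
  by rewrite zP.
have -> : count (fun v => [exists u in A, e v u]) (x :: p) = #|J|.
  rewrite -sum1_count (big_nth x) big_mkord -sum1_card /=.
  by apply: eq_bigl => i; rewrite inE.
have : #|J|%:R * th <= (\sum_(i in J) #|nbhd e (u i) :&: B|)%:R.
  rewrite natr_sum mulr_natl -sumr_const; apply: ler_sum => i /uP /andP[uA _].
  exact: dense.
move/le_trans; apply; rewrite -natrM ler_nat.
have -> : (\sum_(i in J) #|nbhd e (u i) :&: B| = \sum_(y in B) #|[set i in J | e (u i) y]|)%N.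
  transitivity (\sum_(i in J) \sum_(y in B) e (u i) y)%N.
    apply: eq_bigr => i _; rewrite -sum1_card big_mkcond [RHS]big_mkcond /=.
    by apply: eq_bigr => z _; rewrite !inE andbC; case: (z \in B); case: (e _ z).
  rewrite exchange_big; apply: eq_bigr => y _.
  rewrite -sum1_card big_mkcond [RHS]big_mkcond /=.
  by apply: eq_bigr => i _; rewrite !inE; case: [exists _ in _, _]; case: (e _ y).
rewrite mulnC -sum_nat_const; apply: leq_sum => y _; apply: card_close_ord => i j.
rewrite !inE -!(in_set (fun i => [exists u in A, e (v i) u])) -/J.
move=> /andP[iJ uiy] /andP[jJ ujy] ij.
have /andP[_ vui] := uP _ iJ; have /andP[_ vuj] := uP _ jJ.
apply: (@geodesic_shortcut _ _ _ _ i j [:: u i; y; u j; v j] geo) => //.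
  by rewrite ij /= -ltnS ltn_ord.
by rewrite /= vui uiy (e_sym y) ujy (e_sym (u j)) vuj.
Qed.
End Deterministic.

(** * The core of a sampled set *)

Lemma card_fiber_sum (T : finType) (phi : T -> T) (X : {set T}) :
  #|X| = (\sum_r #|[set y in X | phi y == r]|)%N.
Proof.
rewrite -sum1_card (partition_big phi predT) //=; apply: eq_bigr => r _.
by rewrite -sum1_card; apply: eq_bigl => y; rewrite !inE.
Qed.

Lemma half_by_fibers (T : finType) (phi : T -> T) (X D : {set T}) :
  (forall x, x \in X ->
    (#|[set y in X | phi y == phi x]| <= 2 * #|[set y in X | phi y == phi x] :&: D|)%N) ->
  (#|X| <= 2 * #|X :&: D|)%N.
Proof.
move=> h; rewrite (card_fiber_sum phi X) (card_fiber_sum phi (X :&: D)) big_distrr /=.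
apply: leq_sum => r _.
have -> : [set y in X :&: D | phi y == r] = [set y in X | phi y == r] :&: D.
  by apply/setP => y; rewrite !inE andbAC.
have [->|[x]] := set_0Vmem [set y in X | phi y == r]; first by rewrite cards0.
by rewrite inE => /andP[xX /eqP <-]; apply: h.
Qed.

Section Core.
Variables (R : realFieldType) (T : finType) (e : rel T).

(** Components of the subgraph induced by [U] are handled through a relation on
    the whole vertex type, under which a vertex outside [U] is isolated. *)
Definition within (U : {set T}) : rel T := [rel x y | [&& x \in U, y \in U & e x y]].

Definition comp_root (U : {set T}) (x : T) : T := fingraph.root (within U) x.

Definition comp_set (U : {set T}) (x : T) : {set T} :=
  [set y in U | comp_root U y == comp_root U x].

Definition robust (U : {set T}) (th : R) : {set T} :=
  [set u in U | th <= #|nbhd e u :&: U|%:R].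

(** The vertices in components of which at least half is robust.  Being a union
    of components, the core can be coloured by components, and every union of its
    components still is half robust, as the isoperimetric inequality needs. *)
Definition core (U : {set T}) (th : R) : {set T} :=
  [set u in U | (#|comp_set U u| <= 2 * #|comp_set U u :&: robust U th|)%N].

Hypothesis e_sym : symmetric e.

Lemma within_connect_sym (U : {set T}) : connect_sym (within U).
Proof. by apply: sym_connect_sym => x y; rewrite /within /= (e_sym x) andbCA. Qed.

Lemma comp_root_edge (U : {set T}) x y : x \in U -> y \in U -> e x y -> comp_root U x = comp_root U y.
Proof.
move=> xU yU exy; apply/eqP; rewrite root_connect; last exact: within_connect_sym.
by apply: connect1; rewrite /within /= xU yU.
Qed.

Lemma comp_root_label (U : {set T}) (c : T -> T) x y : 
  (forall u v, u \in U -> v \in U -> e u v -> c u = c v) ->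
  comp_root U x = comp_root U y -> c x = c y.
Proof.
move=> cU /eqP; rewrite root_connect; last exact: within_connect_sym.
case/connectP => p + ->; elim: p x => //= z p IH x /andP[/and3P[xU zU exz]] /IH <-.
exact: cU.
Qed.

Variables (U : {set T}) (th : R).

Lemma core_sub u : u \in core U th -> u \in U.
Proof. by rewrite inE => /andP[]. Qed.

Lemma comp_set_eq x y : comp_root U x = comp_root U y -> comp_set U x = comp_set U y.
Proof. by rewrite /comp_set => ->. Qed.

Lemma core_closed x y : y \in U -> comp_root U x = comp_root U y -> x \in core U th -> y \in core U th.
Proof. by move=> yU xy; rewrite !inE yU (comp_set_eq xy) => /andP[]. Qed.

Section Union.
Variable X : {set T}.
Hypothesis XU : X \subset U.
Hypothesis Xcl : forall x y, x \in X -> y \in U -> comp_root U y = comp_root U x -> y \in X.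

Lemma fiber_comp x : x \in X -> [set y in X | comp_root U y == comp_root U x] = comp_set U x.
Proof.
move=> xX; apply/setP => y; rewrite !inE; case: eqP => [yx|_]; rewrite ?andbF // !andbT.
by apply/idP/idP => [/(subsetP XU)//|yU]; apply: Xcl yx.
Qed.

Lemma core_half_robust : X \subset core U th -> (#|X| <= 2 * #|X :&: robust U th|)%N.
Proof.
move=> Xc; apply: (half_by_fibers (phi := comp_root U)) => x xX.
by rewrite fiber_comp //; have := subsetP Xc x xX; rewrite inE => /andP[].
Qed.

Lemma noncore_half_fragile : [disjoint X & core U th] -> (#|X| <= 2 * #|X :\: robust U th|)%N.
Proof.
move=> Xc; rewrite setDE; apply: (half_by_fibers (phi := comp_root U)) => x xX.
rewrite fiber_comp //; have := disjointFr Xc xX; rewrite inE (subsetP XU) //= => /negbT.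
rewrite -ltnNge -setDE; have := cardsID (robust U th) (comp_set U x); lia.
Qed.
End Union.
End Core.

(** With all degrees into [W0] under control, deleting [S0] makes at most a
    constant multiple of [#|S0|] vertices leave the core: a fragile vertex has
    many neighbours in [S0], and [S0] does not have many edges. *)
Section Typical.
Variables (R : realFieldType) (T : finType) (e : rel T).
Hypothesis e_sym : symmetric e.
Variables (W0 : {set T}) (Q : R).
Hypothesis Q_gt0 : 0 < Q.
Hypothesis W0_deg : forall v, Q / 2 <= #|nbhd e v :&: W0|%:R <= 2 * Q.
Variable S0 : {set T}.

Let U := W0 :\: S0.
Let th := Q / 4.

Lemma card_nbhd_split v : (#|nbhd e v :&: W0| <= #|nbhd e v :&: U| + #|nbhd e v :&: S0|)%N.
Proof.
apply: leq_trans (leq_card_setU _ _); apply: subset_leq_card; apply/subsetP => y.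
by rewrite !inE => /andP[-> ->] /=; case: (y \in S0).
Qed.

Lemma fragile_nbrs u : u \in U :\: robust e U th -> Q / 4 <= #|nbhd e u :&: S0|%:R.
Proof.
move=> /setDP[uU]; rewrite inE uU /= -ltNge => h.
have /andP[lo _] := W0_deg u; have := card_nbhd_split u.
by rewrite -(ler_nat R) natrD /th in h * => ?; lra.
Qed.

Lemma card_fragile : #|U :\: robust e U th|%:R <= 8 * #|S0|%:R :> R.
Proof.
have : #|U :\: robust e U th|%:R * (Q / 4) <= (\sum_(u in U :\: robust e U th) #|nbhd e u :&: S0|)%:R.
  rewrite natr_sum mulr_natl -sumr_const; apply: ler_sum => u; exact: fragile_nbrs.
rewrite edge_double_count // natr_sum => h.
have : \sum_(v in S0) #|nbhd e v :&: (U :\: robust e U th)|%:R <= #|S0|%:R * (2 * Q) :> R.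
  rewrite mulr_natl -sumr_const; apply: ler_sum => v _.
  have /andP[_] := W0_deg v; apply: le_trans; rewrite ler_nat subset_leq_card //.
  by apply/subsetP => y; rewrite !inE => /and3P[-> _ /andP[_ ->]].
move=> /(le_trans h) {}h; rewrite -(ler_pM2r Q_gt0); lra.
Qed.

Lemma card_noncore : #|W0 :\: core e U th|%:R <= 17 * #|S0|%:R :> R.
Proof.
pose X := U :\: core e U th.
have X2 : (#|X| <= 2 * #|X :\: robust e U th|)%N.
  apply: noncore_half_fragile; first exact: subsetDl.
    move=> x y /setDP[xU xc] yU yx; rewrite inE yU andbT.
    by apply: contra xc; apply: core_closed.
  by rewrite -setI_eq0; apply/eqP/setP => x; rewrite /X in_setI in_setD in_set0 andbAC andNb.
have h1 : (#|W0 :\: core e U th| <= #|S0| + #|X|)%N.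
  apply: leq_trans (leq_card_setU _ _); apply: subset_leq_card; apply/subsetP => y.
  by rewrite /X !in_setU !in_setD => /andP[-> ->]; case: (y \in S0).
have h2 : (#|X :\: robust e U th| <= #|U :\: robust e U th|)%N.
  by apply: subset_leq_card; apply: setSD; apply: subsetDl.
have := card_fragile; have : (#|W0 :\: core e U th| <= #|S0| + 2 * #|U :\: robust e U th|)%N by lia.
rewrite -(ler_nat R) natrD natrM => ? ?; lra.
Qed.
End Typical.

(** * Weight of a cut of the core *)

Section CutLower.
Variables (R : realFieldType) (T : finType) (e : rel T) (d : nat).
Hypothesis e_sym : symmetric e.
Hypothesis e_reg : regular_graph e d.
Hypothesis d_gt0 : (0 < d)%N.
Variable w : T -> T -> R.
Hypothesis w_ge0 : forall u v, 0 <= w u v.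
Hypothesis w_row : forall u, \sum_v w u v = 1.
Hypothesis w_col : forall v, \sum_u w u v = 1.
Hypothesis w_spread : spreading e w.
Variables (W0 : {set T}) (Q : R).
Hypothesis Q_gt0 : 0 < Q.
Hypothesis W0_deg : forall v, Q / 2 <= #|nbhd e v :&: W0|%:R <= 2 * Q.
Variable S0 : {set T}.

Definition sampled_core : {set T} := core e (W0 :\: S0) (Q / 4).

(** Each vertex [v] is distributed evenly over its neighbours in [W0]; the shares
    falling outside the core are lost, whence sums below one. *)
Definition core_share (v x : T) : R :=
  ((x \in sampled_core) && e v x)%:R / #|nbhd e v :&: W0|%:R.

(** The edge weight [w] transported to the core: the probability weight of an edge
    [u v] of [w] whose ends are assigned to [x] and [y]. *)
Definition core_weight (x y : T) : R :=
  \sum_u \sum_v w u v * (core_share u x * core_share v y).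

Definition color_mismatch (h : T -> T) (u v : T) : R :=
  \sum_x \sum_(y | h x != h y) core_share u x * core_share v y.

Let U := W0 :\: S0.
Let I := sampled_core.
Let r := core_share.

Lemma core_share_ge0 v x : 0 <= r v x.
Proof. by rewrite divr_ge0. Qed.

Lemma W0_deg_gt0 v : 0 < #|nbhd e v :&: W0|%:R :> R.
Proof. by have /andP[h _] := W0_deg v; apply: lt_le_trans h; rewrite divr_gt0. Qed.

Lemma sampled_core_sub : I \subset U.
Proof. by apply/subsetP => x; apply: core_sub. Qed.

Lemma core_share_total v :
  \sum_x r v x = 1 - #|nbhd e v :&: (W0 :\: I)|%:R / #|nbhd e v :&: W0|%:R.
Proof.
have N0 := W0_deg_gt0 v.
rewrite -mulr_suml -[X in X - _](divff (lt0r_neq0 N0)) -mulrBl; congr (_ / _).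
rewrite -natr_sum -big_mkcond /= sum1_card; apply/eqP; rewrite eq_sym subr_eq -natrD eqr_nat.
have -> : #|[pred x | (x \in sampled_core) && e v x]| = #|nbhd e v :&: W0 :&: I|.
  apply: eq_card => x; rewrite !in_setI [x \in nbhd _ _]inE [LHS]inE -/I.
  case xI: (x \in I) => /=; rewrite ?andbF ?andbT //.
  by have := subsetP sampled_core_sub x xI; rewrite inE => /andP[_ ->]; rewrite andbT.
by rewrite -(cardsID I (nbhd e v :&: W0)) setIDA.
Qed.

Lemma core_share_total_le1 v : \sum_x r v x <= 1.
Proof. by rewrite core_share_total lerBlDr lerDl divr_ge0. Qed.

Lemma core_share_mass x : x \in I ->
  d%:R / (2 * Q) <= \sum_v r v x <= 2 * d%:R / Q.
Proof.
move=> xI; have nd : d%:R = \sum_v (e v x)%:R :> R.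
  rewrite -natr_sum -(e_reg x) -sum1_card big_mkcond; congr _%:R; apply: eq_bigr => v _.
  by rewrite inE e_sym; case: (e v x).
have -> : d%:R / (2 * Q) = \sum_v (e v x)%:R / (2 * Q) by rewrite nd mulr_suml.
have -> : 2 * d%:R / Q = \sum_v (e v x)%:R / (Q / 2).
  by rewrite -mulr_suml -nd; field; rewrite gt_eqF.
have Q2 : 0 < Q / 2 by rewrite divr_gt0.
have Q3 : 0 < 2 * Q by rewrite mulr_gt0.
apply/andP; split; apply: ler_sum => v _; rewrite /r /core_share -/I xI /= ler_wpM2l //.
  by rewrite lef_pV2 ?posrE ?W0_deg_gt0 //; case/andP: (W0_deg v).
by rewrite lef_pV2 ?posrE ?W0_deg_gt0 //; case/andP: (W0_deg v).
Qed.

Lemma core_share_missing : \sum_v (1 - \sum_x r v x) <= 34 * #|S0|%:R * d%:R / Q.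
Proof.
apply: (@le_trans _ _ (\sum_v #|nbhd e v :&: (W0 :\: I)|%:R * (2 / Q))).
  apply: ler_sum => v _; rewrite core_share_total opprB addrC subrK ler_wpM2l //.
  rewrite -[2 / Q]invf_div lef_pV2 ?posrE ?W0_deg_gt0 ?divr_gt0 //.
  by case/andP: (W0_deg v).
rewrite -mulr_suml -natr_sum.
have := edge_double_count e_sym [set: T] (W0 :\: I).
rewrite (eq_bigl predT); last by move=> v; rewrite inE.
move=> ->; rewrite (eq_bigr (fun=> d)); last by move=> v _; rewrite setIT e_reg.
rewrite sum_nat_const natrM.
have := card_noncore e_sym Q_gt0 W0_deg S0; rewrite -/I => h.
have h2 : 0 <= d%:R * (2 / Q) :> R by rewrite mulr_ge0 ?divr_ge0 // ltW.
have := ler_wpM2r h2 h; rewrite -mulrA => /le_trans; apply.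
by rewrite le_eqVlt; apply/orP; left; apply/eqP; field; rewrite gt_eqF.
Qed.

(** For a colouring [h] of the core that is constant on components, [f c] is the
    share of colour [c] at each vertex, and [g c] the part of it that comes from
    robust neighbours. *)
Section Coloring.
Variable h : T -> T.
Hypothesis h_comp : forall x y, x \in I -> y \in I ->
  comp_root e U x = comp_root e U y -> h x = h y.

Let A c := [set x in I | h x == c].
Let f c v := \sum_(x | h x == c) r v x.
Let g c v := \sum_(x | (h x == c) && (x \in robust e U (Q / 4))) r v x.
Let a c := \sum_v f c v.

Lemma color_share_ge0 c v : 0 <= f c v.
Proof. by apply: sumr_ge0 => x _; apply: core_share_ge0. Qed.

Lemma sum_color_share v : \sum_c f c v = \sum_x r v x.
Proof. by rewrite [RHS](partition_big h predT). Qed.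

Lemma color_share_le1 c v : f c v <= 1.
Proof.
apply: le_trans (core_share_total_le1 v); rewrite -sum_color_share (bigD1 c) //= lerDl.
by apply: sumr_ge0 => c' _; apply: color_share_ge0.
Qed.

Lemma mass_bounds (P : pred T) :
  #|[set x in I | P x]|%:R * (d%:R / (2 * Q)) <= \sum_v \sum_(x | P x) r v x
    <= #|[set x in I | P x]|%:R * (2 * d%:R / Q).
Proof.
set B := [set x in I | P x]; rewrite exchange_big /=.
have -> : \sum_(x | P x) \sum_v r v x = \sum_(x in B) \sum_v r v x.
  rewrite (bigID (mem I)) /= [X in _ + X]big1 ?addr0.
    by apply: eq_bigl => x; rewrite [RHS]inE andbC.
  move=> x /andP[_ xI]; rewrite big1 // => v _.
  by rewrite /r /core_share -/I (negPf xI) mul0r.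
rewrite ![#|_|%:R * _]mulr_natl -!sumr_const; apply/andP; split; apply: ler_sum => x;
  by rewrite [x \in B]inE => /andP[/core_share_mass/andP[]].
Qed.

(** Colour classes are unions of components of the core. *)
Lemma color_robust c : (#|A c| <= 2 * #|A c :&: robust e U (Q / 4)|)%N.
Proof.
apply: core_half_robust.
- by apply: subset_trans sampled_core_sub; apply/subsetP => x; rewrite [x \in A c]inE => /andP[xI _].
- move=> x y; rewrite [x \in A c]inE [y \in A c]inE => /andP[xI /eqP <-] yU yx.
  have yI : y \in I by apply: core_closed xI; rewrite ?yx.
  by rewrite yI /=; apply/eqP/h_comp.
- by apply/subsetP => x; rewrite [x \in A c]inE => /andP[xI _].
Qed.

(** A class of the colouring cuts off weight of order [d]: a vertex with [g c > 0]
    sees a robust vertex of the class, whose neighbours in the residual set all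
    have the same colour, so that [geodesic_packing] applies. *)
Lemma color_spread c : c \in [set h x | x in I] -> a c <= #|T|%:R / 2 ->
  d%:R / 960 <= \sum_u \sum_v w u v * mismatch (f c u) (f c v).
Proof.
move=> /imsetP[x0 x0I cx0] a_half.
have d0 : 0 < d%:R :> R by rewrite ltr0n.
have A0 : 0 < #|A c|%:R :> R by rewrite ltr0n; apply/card_gt0P; exists x0; rewrite inE x0I cx0 /=.
have /andP[a_lo a_hi] := mass_bounds (fun x => h x == c); rewrite -/(A c) in a_lo a_hi.
have /andP[g_lo _] := mass_bounds (fun x => (h x == c) && (x \in robust e U (Q / 4))).
have a0 : 0 < a c by apply: lt_le_trans a_lo; rewrite mulr_gt0 // divr_gt0 // mulr_gt0.
have X0 : 0 < d%:R / Q by rewrite divr_gt0.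
have halfX : d%:R / (2 * Q) = d%:R / Q / 2 by field; rewrite gt_eqF.
have dblX : 2 * d%:R / Q = 2 * (d%:R / Q) by rewrite mulrA.
have -> : d%:R / 960 = 8^-1 / (3 * (40 / d%:R)) :> R by field; rewrite gt_eqF.
apply: (w_spread (g := g c)).
- by move=> v; apply: sumr_ge0 => x _; apply: core_share_ge0.
- move=> v; rewrite /f (bigID (mem (robust e U (Q / 4)))) /= lerDl.
  by apply: sumr_ge0 => x _; apply: core_share_ge0.
- exact: color_share_le1.
- exact: a0.
- exact: a_half.
- by rewrite invr_ge0.
- have := color_robust c; rewrite -(ler_nat R) natrM.
  have -> : A c :&: robust e U (Q / 4) =
      [set x in I | (h x == c) && (x \in robust e U (Q / 4))].
    by apply/setP => x; rewrite in_setI [x \in A c]inE [RHS]inE andbA.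
  move: g_lo a_hi; rewrite -/(a c) halfX dblX.
  set B := #|_|%:R; set Y := \sum_v _; set m := #|A c|%:R => h1 h2 h3.
  have := ler_wpM2r (ltW X0) h3; rewrite -/(a c); lra.
- by rewrite divr_gt0.
move=> x p geo.
have : (count (fun v => [exists u in A c :&: robust e U (Q / 4), e v u]) (x :: p))%:R * (Q / 4) <=
    5 * #|A c|%:R.
  apply: (geodesic_packing e_sym geo).
  move=> u /setIP[uA]; rewrite inE => /andP[uU]; move/le_trans; apply.
  rewrite ler_nat subset_leq_card //; apply/subsetP => y /setIP[yu yU].
  rewrite in_setI yu /=; move: uA; rewrite [u \in A c]inE [y \in A c]inE => /andP[uI /eqP <-].
  have uy : comp_root e U u = comp_root e U y.
    by apply: comp_root_edge => //; move: yu; rewrite inE.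
  have yI : y \in I by apply: core_closed uI.
  by rewrite yI /= (h_comp uI yI uy).
set m := count _ _; set m' := count _ _ => mQ.
have mm : (m' <= m)%N.
  apply: sub_count => v; apply: contraTT => /existsPn no; rewrite -leNgt /g big1 // => z /andP[hz zr].
  rewrite /r /core_share; case zI: (z \in sampled_core) => //=; last by rewrite mul0r.
  have := no z; rewrite in_setI zr andbT [z \in A c]inE -/I zI hz /= => /negPf ->.
  by rewrite mul0r.
have h1 : m'%:R <= m%:R :> R by rewrite ler_nat.
move: a_lo; rewrite -/(a c) halfX => a_lo.
have -> : 40 / d%:R * a c = (40 * a c) / d%:R by rewrite mulrAC.
rewrite ler_pdivlMr //.
have dQ : d%:R = d%:R / Q * Q :> R by rewrite divfK // gt_eqF.
rewrite dQ mulrA mulrAC; set X := d%:R / Q in X0 a_lo *.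
have h2 := ler_wpM2r (ltW Q_gt0) h1.
have h3 : m'%:R * Q <= 20 * #|A c|%:R by lra.
have := ler_wpM2r (ltW X0) h3; lra.
Qed.

Lemma color_mismatch_share u v :
  color_mismatch h u v = (\sum_x r u x) * (\sum_x r v x) - \sum_c f c u * f c v.
Proof.
rewrite -[X in X * _](sum_color_share u) mulr_suml -sumrB.
rewrite /color_mismatch (partition_big h predT) //=; apply: eq_bigr => c _.
rewrite -mulrBr mulr_suml; apply: eq_bigr => x /eqP hx.
rewrite -mulr_sumr; congr (_ * _).
rewrite [X in _ = X - _](bigID (fun y => h y == c)) /= -/(f c v) addrAC subrr add0r.
by apply: eq_bigl => y; rewrite hx eq_sym.
Qed.

Lemma color_mismatch_ge0 u v : 0 <= color_mismatch h u v.
Proof.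
by apply: sumr_ge0 => x _; apply: sumr_ge0 => y _; rewrite mulr_ge0 // core_share_ge0.
Qed.

Lemma color_mismatch_le1 u v : color_mismatch h u v <= 1.
Proof.
rewrite color_mismatch_share.
have := core_share_total_le1 u; have := core_share_total_le1 v.
set s := \sum_x _; set t := \sum_x _ => s1 t1.
have s0 : 0 <= s by apply: sumr_ge0 => x _; apply: core_share_ge0.
have t0 : 0 <= t by apply: sumr_ge0 => x _; apply: core_share_ge0.
apply: le_trans (_ : t * s <= 1); last by have := ler_pM t0 s0 t1 s1; rewrite mulr1.
rewrite gerBl; apply: sumr_ge0 => x _; apply: mulr_ge0; apply: sumr_ge0 => y _; exact: core_share_ge0.
Qed.

(** The cuts of the single colours count each pair of different colours twice, and
    moreover the pairs of a colour and a lost share. *)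
Lemma color_mismatch_sum u v :
  \sum_c mismatch (f c u) (f c v) <=
  2 * color_mismatch h u v + (1 - \sum_x r u x) + (1 - \sum_x r v x).
Proof.
have -> : \sum_c mismatch (f c u) (f c v) =
  (\sum_x r u x) + (\sum_x r v x) - 2 * \sum_c f c u * f c v.
  rewrite -!sum_color_share mulr_sumr -big_split -sumrB; apply: eq_bigr => c _.
  by rewrite /mismatch /=; ring.
rewrite color_mismatch_share.
have := core_share_total_le1 u; have := core_share_total_le1 v.
set s := \sum_x r u x; set t := \sum_x r v x; set z := \sum_c _ => t1 s1.
rewrite -subr_ge0.
have -> : 2 * (s * t - z) + (1 - s) + (1 - t) - (s + t - 2 * z) = 2 * ((1 - s) * (1 - t)) by ring.
by rewrite !mulr_ge0 ?subr_ge0.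
Qed.

Lemma cut_weight_mismatch :
  cut_weight core_weight h = \sum_u \sum_v w u v * color_mismatch h u v.
Proof.
rewrite /cut_weight /core_weight /color_mismatch.
under eq_bigr do rewrite exchange_big.
rewrite exchange_big; apply: eq_bigr => u _ /=.
under eq_bigr do rewrite exchange_big.
rewrite exchange_big; apply: eq_bigr => v _ /=.
rewrite mulr_sumr; apply: eq_bigr => x _; rewrite mulr_sumr; exact: eq_bigr.
Qed.

(** The masses of the colours add up to at most the order of the graph. *)
Lemma most_colors_small :
  (#|[set h x | x in I]| <= (#|[set c in [set h x | x in I] | (a c <= #|T|%:R / 2)%R]|).+1)%N.
Proof.
set C := [set h x | x in I]; rewrite -(cardsID [set c | a c <= #|T|%:R / 2] C).
have -> : C :&: [set c | (a c <= #|T|%:R / 2)%R] = [set c in C | (a c <= #|T|%:R / 2)%R].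
  by apply/setP => c; rewrite in_setI !in_set.
rewrite -[leqRHS]addn1 leq_add2l; apply/card_le1_eqP => c1 c2 /setDP[_ +] /setDP[_ ].
rewrite !in_set -!ltNge => c1big c2big; apply/eqP; apply: contraT => c12.
have : \sum_c a c <= #|T|%:R.
  rewrite exchange_big /=; apply: (@le_trans _ _ (\sum_(v : T) 1)); last by rewrite sumr_const.
  by apply: ler_sum => v _; rewrite sum_color_share core_share_total_le1.
have a0 c : 0 <= a c by apply: sumr_ge0 => v _; apply: color_share_ge0.
rewrite (bigD1 c1) //= (bigD1 c2) //=.
have : 0 <= \sum_(i | (i != c1) && (i != c2)) a i by apply: sumr_ge0.
by lra.
Qed.

(** All colours but at most one satisfy [color_spread].  As the vertex sums of [w]
    are one, the pairs with a lost share cost at most twice the total loss. *)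
Lemma core_cut_ge :
  (#|[set h x | x in I]|%:R - 1) * (d%:R / 1920) - 34 * #|S0|%:R * d%:R / Q <=
  cut_weight core_weight h.
Proof.
pose D c := \sum_u \sum_v w u v * mismatch (f c u) (f c v).
have f01 c v : 0 <= f c v <= 1 by rewrite color_share_ge0 color_share_le1.
have D0 c : 0 <= D c.
  by do 2 (apply: sumr_ge0 => ? _); rewrite mulr_ge0 // mismatch_ge0.
have low : (#|[set h x | x in I]|%:R - 1) * (d%:R / 960) <= \sum_c D c.
  set C := [set c in [set h x | x in I] | a c <= #|T|%:R / 2].
  apply: (@le_trans _ _ (#|C|%:R * (d%:R / 960))).
    apply: ler_wpM2r; first exact: divr_ge0 (ler0n _ _) (ler0n _ _).
    by rewrite lerBlDr -[X in _ + X]/(1%:R) -natrD ler_nat addn1; apply: most_colors_small.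
  rewrite mulr_natl -sumr_const [X in _ <= X](bigID (mem C)) /= -[X in X <= _]addr0.
  apply: lerD; last by apply: sumr_ge0.
  by apply: ler_sum => c; rewrite inE => /andP[cC ch]; apply: color_spread.
have high : \sum_c D c <= 2 * cut_weight core_weight h + 2 * (34 * #|S0|%:R * d%:R / Q).
  rewrite cut_weight_mismatch /D exchange_big /=.
  apply: (@le_trans _ _ (\sum_u \sum_v w u v * (2 * color_mismatch h u v +
      (1 - \sum_x r u x) + (1 - \sum_x r v x)))).
    apply: ler_sum => u _; rewrite exchange_big /=; apply: ler_sum => v _.
    by rewrite -mulr_sumr ler_wpM2l // color_mismatch_sum.
  have -> : \sum_u \sum_v w u v * (2 * color_mismatch h u v +
      (1 - \sum_x r u x) + (1 - \sum_x r v x)) =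
     2 * (\sum_u \sum_v w u v * color_mismatch h u v) +
     \sum_u (\sum_v w u v) * (1 - \sum_x r u x) +
     \sum_v (\sum_u w u v) * (1 - \sum_x r v x).
    under [X in _ = _ + X]eq_bigr do rewrite mulr_suml.
    rewrite [X in _ = _ + X]exchange_big mulr_sumr -!big_split; apply: eq_bigr => u _ /=.
    rewrite mulr_sumr mulr_suml -!big_split; apply: eq_bigr => v _ /=; ring.
  under [X in _ + X + _ <= _]eq_bigr do rewrite w_row mul1r.
  under [X in _ + X <= _]eq_bigr do rewrite w_col mul1r.
  have := core_share_missing; lra.
lra.
Qed.
End Coloring.
End CutLower.

(** * Separators of the sampled graph *)

(** The components left by a separator [S] enter only through a labelling [c] of
    the vertices that is constant along the edges avoiding [S]. *)
Section Separator.
Variables (R : realFieldType) (T : finType) (e : rel T).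
Hypothesis e_sym : symmetric e.
Variables (W0 W : {set T}) (Q : R).
Hypothesis W0W : W0 \subset W.
Hypothesis Q_gt0 : 0 < Q.
Hypothesis W0_deg : forall v, Q / 2 <= #|nbhd e v :&: W0|%:R <= 2 * Q.
Variables (S : {set T}) (c : T -> T).
Hypothesis c_edge : forall x y, x \in W :\: S -> y \in W :\: S -> e x y -> c x = c y.

Let S0 := S :&: W0.
Let U := W0 :\: S0.
Let I := sampled_core e W0 Q S0.

Lemma residual_sub : U \subset W :\: S.
Proof.
apply/subsetP => x; rewrite !inE => /andP[+ xW0]; rewrite xW0 andbT => ->.
by rewrite (subsetP W0W).
Qed.

Lemma core_sub_residual : I \subset U.
Proof. exact: sampled_core_sub. Qed.

Lemma label_comp x y : comp_root e U x = comp_root e U y -> c x = c y.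
Proof.
apply: comp_root_label => // u v uU vU.
by apply: c_edge; apply: (subsetP residual_sub).
Qed.

(** If [g] agrees with the labelling on the core, then an edge of the sampled
    graph that avoids [S] carries no mismatch: its ends, and all core neighbours
    of its ends, have the same label. *)
Section Crossing.
Variable w : T -> T -> R.
Hypothesis w_ge0 : forall u v, 0 <= w u v.
Hypothesis w_edge : forall u v, w u v != 0 -> e u v.
Hypothesis w_row : forall u, \sum_v w u v = 1.
Hypothesis w_col : forall v, \sum_u w u v = 1.
Variable g : T -> T.
Hypothesis gc : forall x, x \in I -> g x = c x.

Lemma color_mismatch_eq0 u v : u \in W :\: S -> v \in W :\: S -> e u v ->
  color_mismatch e W0 Q S0 g u v = 0.
Proof.
move=> uW vW euv; rewrite /color_mismatch.
have see z x : z \in W :\: S -> core_share e W0 Q S0 z x != 0 -> g x = c z.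
  move=> zW; rewrite /core_share; case: (boolP (x \in _)) => [xI|]; last by rewrite mul0r eqxx.
  case: (boolP (e z x)) => [ezx _|]; last by rewrite mul0r eqxx.
  rewrite gc //; apply/esym/c_edge => //.
  by apply: (subsetP residual_sub); apply: (subsetP core_sub_residual).
rewrite big1 // => x _; rewrite big1 // => y gxy; apply/eqP; apply: contraR gxy.
rewrite mulf_eq0 negb_or => /andP[/(see _ _ uW) -> /(see _ _ vW) ->].
by apply/eqP/c_edge.
Qed.

Lemma crossing_le (W1 W2 : {set T}) : W1 \subset W -> W2 \subset W ->
  \sum_(u in W1) \sum_(v in W2) w u v * color_mismatch e W0 Q S0 g u v <= 2 * #|S|%:R.
Proof.
move=> W1W W2W.
apply: (@le_trans _ _ (\sum_(u in W1) \sum_(v in W2)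
    ((if u \in S then w u v else 0) + (if v \in S then w u v else 0)))).
  apply: ler_sum => u uW1; apply: ler_sum => v vW2.
  have cm1 := color_mismatch_le1 Q_gt0 W0_deg S0 g u v; have cm0 := color_mismatch_ge0 e W0 Q S0 g u v.
  have wc : w u v * color_mismatch e W0 Q S0 g u v <= w u v by rewrite ler_piMr.
  have [uS|uS] := boolP (u \in S); first by case: ifP; rewrite ?addr0 // => _; rewrite (le_trans wc) // lerDl.
  have [vS|vS] := boolP (v \in S); first by rewrite add0r.
  have [->|/w_edge euv] := eqVneq (w u v) 0; first by rewrite mul0r addr0.
  have uWS : u \in W :\: S by rewrite in_setD uS (subsetP W1W).
  have vWS : v \in W :\: S by rewrite in_setD vS (subsetP W2W).
  by rewrite (color_mismatch_eq0 uWS vWS euv) mulr0 addr0.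
have drop (A : {set T}) (F : T -> R) : (forall x, 0 <= F x) -> \sum_(x in A) F x <= \sum_x F x.
  by move=> F0; rewrite [X in _ <= X](bigID (mem A)) /= lerDl sumr_ge0.
have i0 b u v : 0 <= (if b then w u v else 0) by case: b.
apply: (@le_trans _ _ (\sum_u \sum_v ((if u \in S then w u v else 0) + (if v \in S then w u v else 0)))).
  apply: le_trans (drop _ _ _) _.
    by move=> u; apply: sumr_ge0 => v _; rewrite addr_ge0.
  by apply: ler_sum => u _; apply: drop => v; rewrite addr_ge0.
under eq_bigr do rewrite big_split /=.
rewrite big_split /= [X in _ + X]exchange_big /=.
have E (F : T -> R) : (forall u, F u = 1) -> \sum_(u in S) F u = #|S|%:R.
  by move=> F1; rewrite -sumr_const; apply: eq_bigr.
have -> : \sum_i \sum_j (if i \in S then w i j else 0) = #|S|%:R.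
  rewrite -(E _ w_row) [RHS]big_mkcond; apply: eq_bigr => u _; case: ifP => // _; exact: big1.
have -> : \sum_j \sum_i (if j \in S then w i j else 0) = #|S|%:R.
  rewrite -(E _ w_col) [RHS]big_mkcond; apply: eq_bigr => u _; case: ifP => // _; exact: big1.
lra.
Qed.
End Crossing.

Section Counting.
Variables (P eta : R).
Hypothesis PQ : P = 3 * Q.
Hypothesis eta01 : 0 < eta <= 1 / 12.
Hypothesis W_deg : forall v, (1 - eta) * P <= #|nbhd e v :&: W|%:R <= (1 + eta) * P.
Hypothesis Q_ge : 96 <= Q.
Hypothesis etaQ : 4 <= eta * Q.

(* [C l] is a union of components; a label is thin if it misses the core. *)
Let C l := [set v in W :\: S | c v == l].
Let thin := [set l in [set c v | v in W :\: S] | l \notin [set c v | v in I]].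

Lemma class_nbhd_split l v : v \in C l ->
  (#|nbhd e v :&: W| <= #|nbhd e v :&: S| + #|nbhd e v :&: C l|)%N.
Proof.
rewrite [v \in _]inE => /andP[vU /eqP cv].
apply: leq_trans (leq_card_setU _ _); apply: subset_leq_card; apply/subsetP => y.
rewrite in_setI => /andP[yv yW]; rewrite in_setU !in_setI yv /=.
case yS: (y \in S) => //=; have yU : y \in W :\: S by rewrite in_setD yS yW.
by rewrite inE yU /= -cv eq_sym; apply/eqP/c_edge => //; move: yv; rewrite inE.
Qed.

(** A thin class sends about [P] edges to [S].  If it has at most [eta * P]
    vertices, then one vertex alone does so.  Otherwise either all its vertices
    have many neighbours in [S]; or some vertex does not, in which case the
    class contains a quarter of [Q] vertices of [W0] outside the core, half of
    them fragile, and these have many neighbours in [S]. *)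
Lemma thin_class l : l \in thin ->
  (1 - 2 * eta) * P <= (\sum_(v in C l) #|nbhd e v :&: S|)%:R /\ Q / 8 <= #|S|%:R.
Proof.
move=> /setIdP[/imsetP[v0 v0U lv0] lI]; have /andP[eta0 eta1] := eta01.
have Q0 := Q_gt0; have Q96 := Q_ge; have eQ := etaQ.
have P0 : 0 < P by rewrite PQ mulr_gt0.
have v0C : v0 \in C l by rewrite inE v0U lv0 /=.
have one v : v \in C l -> #|nbhd e v :&: S|%:R <= (\sum_(v in C l) #|nbhd e v :&: S|)%:R :> R.
  by move=> vC; rewrite ler_nat (bigD1 v) //= leq_addr.
have leS v : #|nbhd e v :&: S|%:R <= #|S|%:R :> R by rewrite ler_nat subset_leq_card // subsetIr.
have [Csmall|Cbig] := leP #|C l|%:R (eta * P).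
  have := class_nbhd_split v0C; rewrite -(ler_nat R) natrD => h.
  have /andP[dlo _] := W_deg v0.
  have h2 : #|nbhd e v0 :&: C l|%:R <= #|C l|%:R :> R by rewrite ler_nat subset_leq_card // subsetIr.
  have h3 : (1 - 2 * eta) * P <= #|nbhd e v0 :&: S|%:R by lra.
  split; first exact: le_trans (one _ v0C).
  apply: le_trans (leS v0); apply: le_trans h3; rewrite PQ.
  have : 0 <= (1 / 12 - eta) * Q by rewrite mulr_ge0 ?subr_ge0 // ltW.
  by move=> ?; lra.
have sum_ge (X : {set T}) (m th : R) : X \subset C l -> m <= #|X|%:R -> 0 <= th ->
    (forall v, v \in X -> th <= #|nbhd e v :&: S|%:R) ->
    m * th <= (\sum_(v in C l) #|nbhd e v :&: S|)%:R.
  move=> XC mX th0 hX; apply: (@le_trans _ _ (#|X|%:R * th)); first by rewrite ler_wpM2r.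
  apply: (@le_trans _ _ (\sum_(v in X) #|nbhd e v :&: S|%:R)).
    by rewrite mulr_natl -sumr_const; apply: ler_sum.
  rewrite natr_sum [X in _ <= X](bigID (mem X)) /= [X in _ <= X + _](eq_bigl (mem X)) ?lerDl ?sumr_ge0 //.
  by move=> v /=; case vX: (v \in X); rewrite ?andbF // (subsetP XC).
have Q4 : 0 <= Q / 4 by rewrite divr_ge0 // ltW.
have lowP : (1 - 2 * eta) * P <= P by rewrite ger_pMl //; lra.
have [/forall_inP allbad|] := boolP [forall v in C l, Q / 4 <= #|nbhd e v :&: S|%:R].
  split; last by apply: le_trans (leS v0); have := allbad _ v0C; lra.
  apply: le_trans (sum_ge (C l) (eta * P) (Q / 4) _ (ltW Cbig) Q4 allbad) => //.
  apply: le_trans lowP _.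
  have -> : eta * P * (Q / 4) = (eta * Q / 4) * P by field.
  by rewrite ler_pMl //; lra.
rewrite negb_forall_in => /exists_inP[v vC]; rewrite -ltNge => vS.
pose X := C l :&: W0.
have XU : X \subset U.
  by apply/subsetP => x; rewrite /U /S0 !inE => /andP[/andP[/andP[/negPf -> _] _] ->].
have Xfrag : (#|X| <= 2 * #|X :\: robust e U (Q / 4)|)%N.
  apply: noncore_half_fragile => //.
    move=> x y; rewrite !in_setI => /andP[xC _] yU yx.
    move: xC; rewrite [x \in _]inE [y \in C l]inE => /andP[_ /eqP <-].
    by rewrite (label_comp yx) eqxx (subsetP residual_sub) //=; move: yU; rewrite inE => /andP[].
  rewrite -setI_eq0; apply/eqP/setP => x; rewrite in_set0; apply/negP => /setIP[xX xI].
  case/negP: lI; apply/imsetP; exists x => //.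
  by move: xX; rewrite in_setI [x \in C l]inE => /andP[/andP[_ /eqP ->]].
have Xbig : Q / 4 <= #|X|%:R.
  have /andP[lo _] := W0_deg v.
  have : (#|nbhd e v :&: W0| <= #|nbhd e v :&: S| + #|X|)%N.
    apply: leq_trans (leq_card_setU _ _); apply: subset_leq_card; apply/subsetP => y.
    rewrite in_setI => /andP[yv yW]; rewrite in_setU !in_setI yv yW /= andbT.
    case yS: (y \in S) => //=; have yU : y \in W :\: S by rewrite in_setD yS (subsetP W0W).
    move: vC; rewrite [v \in _]inE => /andP[vU /eqP cv].
    by rewrite inE yU /= -cv eq_sym; apply/eqP/c_edge => //; move: yv; rewrite inE.
  rewrite -(ler_nat R) natrD => ?; lra.
have fragS x : x \in X :\: robust e U (Q / 4) -> Q / 4 <= #|nbhd e x :&: S|%:R.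
  move=> /setDP[xX xr]; apply: le_trans (fragile_nbrs W0_deg (S0 := S0) (u := x) _) _.
    by rewrite in_setD xr (subsetP XU).
  by rewrite ler_nat subset_leq_card // setIS // subsetIl.
have Xf8 : Q / 8 <= #|X :\: robust e U (Q / 4)|%:R.
  by move: Xfrag; rewrite -(ler_nat R) natrM; lra.
split.
  apply: le_trans (sum_ge _ (Q / 8) (Q / 4) _ Xf8 Q4 fragS).
    apply: le_trans lowP _; rewrite PQ.
    have : 0 <= (Q - 96) * Q by rewrite mulr_ge0 ?subr_ge0 // ltW.
    by lra.
  by apply/subsetP => x /setDP[/setIP[]].
have /card_gt0P[x xf] : (0 < #|X :\: robust e U (Q / 4)|)%N.
  by rewrite -(ltr_nat R); apply: lt_le_trans Xf8; rewrite divr_gt0.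
by apply: le_trans (leS x); have := fragS _ xf; lra.
Qed.

Lemma thin_count : #|thin|%:R * (1 - 2 * eta) <= #|S|%:R * (1 + eta).
Proof.
have P0 : 0 < P by rewrite PQ mulr_gt0.
rewrite -(ler_pM2r P0) -!mulrA.
apply: (@le_trans _ _ (\sum_(l in thin) (\sum_(v in C l) #|nbhd e v :&: S|)%:R)).
  by rewrite [#|thin|%:R * _]mulr_natl -sumr_const; apply: ler_sum => l /thin_class[].
apply: (@le_trans _ _ (\sum_(v in W :\: S) #|nbhd e v :&: S|)%:R).
  rewrite -natr_sum ler_nat [X in (_ <= X)%N](partition_big c predT) //= [X in (_ <= X)%N](bigID (mem thin)) /=.
  apply: leq_trans _ (leq_addr _ _); apply: leq_sum => l _; apply/eq_leq/eq_bigl => v.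
  by rewrite inE.
rewrite edge_double_count // natr_sum [#|S|%:R * _]mulr_natl -sumr_const; apply: ler_sum => v _.
have /andP[_] := W_deg v; apply: le_trans; rewrite ler_nat subset_leq_card //.
by apply: setIS; apply: subsetDl.
Qed.

(** Thin classes number at most [(1 + eta) / (1 - 2 eta)] times [#|S|], which
    falls short of [#|S| / (1 - eps)] by a constant factor when [eta = eps / 6];
    the remaining classes all meet the core. *)
Lemma separator_splits_core (eps : R) (K : nat) :
  0 < eps <= 1 / 2 -> eta = eps / 6 -> 2 <= K%:R * eps -> K%:R < Q / 8 ->
  (2 <= #|[set c v | v in W :\: S]|)%N ->
  #|S|%:R < (1 - eps) * #|[set c v | v in W :\: S]|%:R ->
  (2 <= #|[set c v | v in I]|)%N /\ (#|S| <= K * #|[set c v | v in I]|)%N.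
Proof.
move=> /andP[eps0 eps1] etaE Keps KQ k2 Sk.
set t := #|[set c v | v in I]|; set k := #|[set c v | v in W :\: S]| in k2 Sk *.
have kt : (k <= t + #|thin|)%N.
  apply: leq_trans (leq_card_setU _ _); apply: subset_leq_card; apply/subsetP => l lU.
  by rewrite in_setU; case lI: (l \in [set c v | v in I]) => //=; rewrite /thin in_set lU lI.
have S_lt : #|S|%:R * eps < 2 * t%:R.
  have := thin_count; move: kt; rewrite -(ler_nat R) natrD.
  move: Sk; set x := #|S|%:R; set y := #|thin|%:R; set z := t%:R; set kk := k%:R => h1 h2 h3.
  have x0 : 0 <= x by []. have y0 : 0 <= y by []. have z0 : 0 <= z by [].
  have h4 : x < (1 - eps) * (z + y).
    by apply: lt_le_trans h1 _; rewrite ler_wpM2l //; lra.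
  have e1 : y * (1 - eps) <= x * (1 - eps / 2).
    have pos : 0 < 1 - 2 * eta by lra.
    rewrite -(ler_pM2r pos).
    apply: (@le_trans _ _ (x * (1 + eta) * (1 - eps))).
      by rewrite mulrAC ler_wpM2r //; lra.
    rewrite -!mulrA ler_wpM2l // etaE.
    by have := sqr_ge0 eps; have := mulr_ge0 (ltW eps0) (ltW eps0); lra.
  have : 0 <= z * eps by rewrite mulr_ge0 // ltW.
  by lra.
have SKt : (#|S| <= K * t)%N.
  rewrite -(ler_nat R) natrM -(ler_pM2r eps0).
  have : 2 * t%:R <= K%:R * eps * t%:R by rewrite ler_wpM2r.
  by lra.
split=> //; rewrite ltnNge; apply/negP => t1.
have [l lthin] : exists l, l \in thin.
  apply/card_gt0P; rewrite lt0n; apply: contraTneq (leq_trans k2 kt) => ->.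
  by rewrite addn0 -ltnNge.
have [_ SQ] := thin_class lthin.
have : #|S|%:R <= K%:R :> R.
  by rewrite ler_nat; apply: leq_trans SKt _; rewrite -[leqRHS]muln1 leq_mul2l t1 orbT.
lra.
Qed.
End Counting.
End Separator.

(** Translates the components of an induced subgraph of an induced subgraph, a
    nested subset type, into a labelling of the ambient vertices. *)
Lemma not_tough_separator (R : realFieldType) (T : finType) (e : rel T) (W : {set T}) (s : R) :
  symmetric e -> 0 <= s -> ~~ tough (induced_subgraph e W) s ->
  exists (S : {set T}) (c : T -> T),
  [/\ S \subset W,
      forall x y, x \in W :\: S -> y \in W :\: S -> e x y -> c x = c y,
      (2 <= #|[set c v | v in (W :\: S)%SET]|)%N &
      #|S|%:R < s * #|[set c v | v in (W :\: S)%SET]|%:R].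
Proof.
move=> e_sym s0; rewrite negb_forall => /existsP[S1]; rewrite negb_imply -ltNge => /andP[k2 Sk].
set e2 := induced_subgraph _ (~: S1) in k2 Sk.
have e2_sym : connect_sym e2.
  by apply: sym_connect_sym => x y; rewrite /e2 /induced_subgraph e_sym.
pose emb (z : {y : {x : T | x \in W} | y \in ~: S1}) : T := val (val z).
pose lift2 (x : T) : option {y : {x : T | x \in W} | y \in ~: S1} :=
  obind (fun y : {x : T | x \in W} => insub y) (insub x).
have liftK z : lift2 (emb z) = Some z by rewrite /lift2 /emb valK /= valK.
pose c x := if lift2 x is Some z then emb (fingraph.root e2 z) else x.
pose S := [set val y | y in S1].
have liftP x : x \in W :\: S -> exists z, x = emb z.
  rewrite inE => /andP[xS xW].
  have yS : exist (fun x => x \in W) x xW \in ~: S1.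
    by rewrite inE; apply: contra xS => xS1; apply/imsetP; exists (exist _ x xW).
  by exists (exist (fun y => y \in ~: S1) (exist (fun x => x \in W) x xW) yS).
have embP z : emb z \in W :\: S.
  rewrite inE /emb (valP (val z)) andbT; apply/imsetP => -[y yS /val_inj zy].
  by have := valP z; rewrite inE zy yS.
have kle : (num_components e2 <= #|[set c v | v in (W :\: S)%SET]|)%N.
  rewrite /num_components /n_comp_mem -(card_imset (f := emb)); last first.
    by move=> z1 z2 /val_inj/val_inj.
  apply: subset_leq_card; apply/subsetP => x /imsetP[z].
  rewrite inE => /andP[/eqP rz _] ->; apply/imsetP; exists (emb z) => //.
  by rewrite /c liftK rz.
have cardS : #|S| = #|S1| by apply: card_imset; apply: val_inj.
exists S, c; split.
- by apply/subsetP => x /imsetP[y _ ->]; apply: valP.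
- move=> x y /liftP[zx ->] /liftP[zy ->] exy; rewrite /c !liftK; congr emb.
  by apply/eqP; rewrite root_connect //; apply: connect1.
- exact: leq_trans kle.
- rewrite cardS; apply: lt_le_trans Sk _; by rewrite ler_wpM2l // ler_nat.
Qed.

Lemma card_small_sets (T : finType) (m : nat) :
  (#|[set S : {set T} | (#|S| <= m)%N]| <= #|T|.+1 ^ m)%N.
Proof.
pose F (f : {ffun 'I_m -> option T}) : {set T} := [set x | [exists i, f i == Some x]].
have -> : (#|T|.+1 ^ m)%N = #|{ffun 'I_m -> option T}| by rewrite card_ffun card_option card_ord.
apply: leq_trans (leq_imset_card F predT).
apply: subset_leq_card; apply/subsetP => S; rewrite inE => Sm.
apply/imsetP; exists [ffun i : 'I_m => nth None [seq Some x | x <- enum S] i] => //.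
apply/setP => x; rewrite inE; apply/idP/existsP => [xS|[i]].
  have ix : (index x (enum S) < m)%N.
    by apply: leq_trans Sm; rewrite cardE index_mem mem_enum.
  exists (Ordinal ix); rewrite ffunE /= (nth_map x) ?nth_index ?mem_enum //.
  by rewrite index_mem mem_enum.
rewrite ffunE; have [im|im] := ltnP i (size (enum S)).
  by rewrite (nth_map x) // => /eqP[<-]; rewrite -mem_enum mem_nth.
by rewrite nth_default // size_map.
Qed.

Lemma geometric_tail (R : realFieldType) (r : R) (N : nat) : 0 <= r <= 1 / 2 ->
  \sum_(i < N | (2 <= i)%N) r ^+ i <= r.
Proof.
move=> /andP[r0 r1].
have H m : \sum_(i < m.+2 | (2 <= i)%N) r ^+ i <= r - r ^+ m.+1.
  elim: m => [|m IH]; first by rewrite big_mkcond !big_ord_recr big_ord0 /= !addr0 expr1 subrr.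
  rewrite big_mkcond big_ord_recr -big_mkcond /=.
  have := exprn_ge0 m.+1 r0; rewrite [r ^+ m.+2]exprS => h.
  have : 0 <= (1 / 2 - r) * r ^+ m.+1 by rewrite mulr_ge0 // subr_ge0.
  lra.
case: N => [|[|m]].
- by rewrite big_ord0.
- by rewrite big_mkcond big_ord_recr big_ord0 /= addr0.
- by apply: le_trans (H m) _; rewrite lerBlDr lerDl exprn_ge0.
Qed.

(** * Union bound over candidate colourings *)

Section Candidates.
Variables (R : realType) (T : finType) (e : rel T) (d : nat).
Hypothesis e_sym : symmetric e.
Hypothesis e_reg : regular_graph e d.
Hypothesis d_gt0 : (0 < d)%N.
Variable w : T -> T -> R.
Hypothesis w_ge0 : forall u v, 0 <= w u v.
Hypothesis w_edge : forall u v, w u v != 0 -> e u v.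
Hypothesis w_row : forall u, \sum_v w u v = 1.
Hypothesis w_col : forall v, \sum_u w u v = 1.
Hypothesis w_spread : spreading e w.
Variables (W0 : {set T}) (Q : R) (K : nat).
Hypothesis Q_gt0 : 0 < Q.
Hypothesis W0_deg : forall v, Q / 2 <= #|nbhd e v :&: W0|%:R <= 2 * Q.
Hypothesis Q_large : 34 * (80 * 96) * K%:R <= Q.

(** Gluing everything outside the core to one core vertex lets colourings of the
    core be colourings of the vertex type with the same number of colours. *)
Definition retract (I : {set T}) (x : T) : T :=
  if x \in I then x else odflt x [pick i in I].

Lemma retract_in (I : {set T}) x : I != finset.set0 -> retract I x \in I.
Proof.
rewrite /retract; case: ifP => // _ /finset.set0Pn[i iI].
by case: pickP => //= /(_ i); rewrite iI.
Qed.

Lemma retract_id (I : {set T}) x : x \in I -> retract I x = x.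
Proof. by rewrite /retract => ->. Qed.

Section FixedSeparator.
Variable S0 : {set T}.
Let I := sampled_core e W0 Q S0.
Let cut := cut_weight (core_weight e w W0 Q S0).
Let lam : R := d%:R / (80 * 96).

Definition comp_coloring (x : T) : T := comp_root e (W0 :\: S0) (retract I x).

(** What is known of the partition of the core by the components of the sampled
    graph minus a small separator, without reference to later rounds. *)
Definition candidate (g : T -> T) : bool :=
  [&& I != finset.set0, coarsens comp_coloring g, (2 <= color_count g)%N & (#|S0| <= K * color_count g)%N].

Lemma cut_unit_gt0 : 0 < lam. Proof. by rewrite divr_gt0 ?mulr_gt0 ?ltr0n. Qed.

Lemma core_weight_ge0 x y : 0 <= core_weight e w W0 Q S0 x y.
Proof.
by apply: sumr_ge0 => u _; apply: sumr_ge0 => v _; rewrite !mulr_ge0 // core_share_ge0.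
Qed.

Lemma color_count_core (h : T -> T) : I != finset.set0 -> coarsens comp_coloring h ->
  color_count h = #|[set h x | x in I]|.
Proof.
move=> I0 /coarsensP hc; apply: eq_card => z; apply/imsetP/imsetP => [[x _ ->]|[x _ ->]].
  exists (retract I x); first exact: retract_in.
  by apply: hc; rewrite /comp_coloring (retract_id (retract_in _ I0)).
by exists x.
Qed.

Lemma candidate_cut (h : T -> T) : candidate h -> (color_count h)%:R * lam <= cut h.
Proof.
case/and4P => I0 hc k2 SK.
have := core_cut_ge e_sym e_reg d_gt0 w_ge0 w_row w_col w_spread Q_gt0 W0_deg (S0 := S0) (h := h).
rewrite -color_count_core // => low; apply: le_trans (low _) => {low}; last first.
  move=> x y xI yI xy; move/coarsensP: hc; apply.
  by rewrite /comp_coloring !retract_id.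
move: k2 SK; rewrite -!(ler_nat R) natrM /lam.
set k := (color_count h)%:R; set s := #|S0|%:R => k2 SK.
have d0 : 0 <= d%:R :> R by []. have Q0 := Q_gt0.
have sQ : s / Q <= k / (34 * (80 * 96)).
  rewrite ler_pdivrMr //; apply: le_trans SK _.
  have k0 : 0 <= k by apply: le_trans k2.
  have := ler_wpM2r k0 Q_large; lra.
have := ler_wpM2r d0 sQ; have := ler_wpM2r d0 k2.
have -> : 34 * s * d%:R / Q = 34 * (s / Q * d%:R) by field; rewrite gt_eqF.
lra.
Qed.

Lemma candidate_count (a : nat) : (2 <= a)%N -> (#|S0| <= K * a)%N ->
  (#|[set g : {ffun T -> T} | candidate g && (cut g <= a%:R * lam)%R]| <= #|T| ^ (2 * a))%N.
Proof.
move=> a2 SKa; have [I0|I0] := boolP (I != finset.set0); last first.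
  rewrite [X in (X <= _)%N](_ : _ = 0)%N //; apply/eqP; rewrite cards_eq0; apply/eqP/setP => g.
  by rewrite !inE /candidate (negPf I0).
have T0 : (0 < #|T|)%N by case/finset.set0Pn: I0 => i _; apply/card_gt0P; exists i.
apply: leq_trans (@count_light_colorings R T (core_weight e w W0 Q S0) core_weight_ge0 lam a comp_coloring cut_unit_gt0 _ T0).
  apply: subset_leq_card; apply/subsetP => g; rewrite !inE => /andP[/and4P[_ -> _ _] ->].
  by [].
move=> h hc ah; apply: candidate_cut; rewrite /candidate I0 hc /=.
by rewrite (leq_trans a2 (ltnW ah)) (leq_trans SKa) // leq_mul2l (ltnW ah) orbT.
Qed.

Lemma cut_le_card (h : T -> T) : cut h <= #|T|%:R.
Proof.
rewrite /cut cut_weight_mismatch; apply: (@le_trans _ _ (\sum_u \sum_v w u v)).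
  apply: ler_sum => u _; apply: ler_sum => v _; rewrite ler_piMr //.
  exact: color_mismatch_le1.
by under eq_bigr do rewrite w_row; rewrite sumr_const.
Qed.
End FixedSeparator.

Section Sum.
Variables (kappa : R).
Hypothesis kappa_ge0 : 0 <= kappa.
Let lam : R := d%:R / (80 * 96).
Let rho : R := #|T|%:R ^+ (4 + 2 * K) * expR (2 * K%:R - kappa * lam).
Hypothesis rho_small : rho <= 1 / 2.
Hypothesis T_gt1 : (1 < #|T|)%N.

(** The sum is organised by the level [a], the integer part of the cut weight
    measured in units of [lam].  A candidate has at most [a] colours, so level [a]
    carries at most [(n + 1)^(K a)] sets [S0] and [n^(2 (a + 1))] colourings, and
    the terms decay geometrically in [a >= 2]. *)
Lemma candidate_sum :
  \sum_(S0 : {set T}) \sum_(g : {ffun T -> T} | candidate S0 g)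
     expR (2 * K%:R * (color_count g)%:R - kappa * cut_weight (core_weight e w W0 Q S0) g)
  <= rho.
Proof.
pose cut S0 (g : {ffun T -> T}) := cut_weight (core_weight e w W0 Q S0) g.
have l0 : 0 < lam by exact: cut_unit_gt0.
pose N := (Num.truncn (#|T|%:R / lam)).+1.
have cutN S0 (g : {ffun T -> T}) : (Num.truncn (cut S0 g / lam) < N)%N.
  rewrite ltnS; apply: le_truncn; rewrite ler_pM2r ?invr_gt0 //; exact: cut_le_card.
pose lev S0 (g : {ffun T -> T}) : 'I_N := Ordinal (cutN S0 g).
have cut0 S0 (g : {ffun T -> T}) : 0 <= cut S0 g.
  by apply: sumr_ge0 => x _; apply: sumr_ge0 => y _; apply: core_weight_ge0.
have levP S0 (g : {ffun T -> T}) : (lev S0 g)%:R * lam <= cut S0 g < (lev S0 g).+1%:R * lam.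
  rewrite -ler_pdivlMr // -ltr_pdivrMr // /lev /=.
  by apply: truncn_itv; rewrite divr_ge0 // ltW.
have lev_count S0 (g : {ffun T -> T}) : candidate S0 g -> (color_count g <= lev S0 g)%N.
  move=> /candidate_cut h; rewrite -ltnS -(ltr_nat R) -(ltr_pM2r l0).
  by apply: le_lt_trans h _; case/andP: (levP S0 g).
apply: (@le_trans _ _ (\sum_(a < N | (2 <= a)%N) rho ^+ a)); last first.
  apply: geometric_tail; rewrite rho_small andbT /rho mulr_ge0 ?expR_ge0 // exprn_ge0 //.
apply: (@le_trans _ _ (\sum_(S0 : {set T}) \sum_(a < N | (2 <= a)%N && (#|S0| <= K * a)%N)
   \sum_(g : {ffun T -> T} | candidate S0 g && (cut S0 g <= a.+1%:R * lam))
     expR (2 * K%:R - kappa * lam) ^+ a)).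
  apply: ler_sum => S0 _; rewrite (partition_big (lev S0) (fun a => (2 <= a)%N && (#|S0| <= K * a)%N)) /=.
    apply: ler_sum => a _.
    rewrite [X in _ <= X](bigID (fun g => lev S0 g == a)) /= -[X in X <= _]addr0.
    apply: lerD; last by apply: sumr_ge0 => g _; rewrite exprn_ge0 // expR_ge0.
    rewrite [X in X <= _](eq_bigl (fun g : {ffun T -> T} => candidate S0 g && (cut S0 g <= a.+1%:R * lam) && (lev S0 g == a))).
      apply: ler_sum => g /andP[/andP[cg _] /eqP <-].
      rewrite -expRM_natl ler_expR.
      have := lev_count S0 g cg; have /andP[lo _] := levP S0 g; rewrite -(ler_nat R) => ct.
      have := ler_wpM2l kappa_ge0 lo; have K0 : 0 <= 2 * K%:R :> R by rewrite mulr_ge0.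
      have := ler_wpM2l K0 ct; rewrite -/(cut S0 g); lra.
    move=> g; case: eqP => [<-|_]; rewrite ?andbF ?andbT //.
    by have /andP[_ /ltW ->] := levP S0 g; rewrite andbT.
  move=> g cg; have h := lev_count S0 g cg; case/and4P: cg => _ _ c2 cK.
  by rewrite (leq_trans c2 h) (leq_trans cK) // leq_mul2l h orbT.
rewrite (exchange_big_dep (fun a : 'I_N => (2 <= a)%N)) /=; last by move=> S0 a _ /andP[].
apply: ler_sum => a a2.
set E := expR _ ^+ a; have E0 : 0 <= E by rewrite exprn_ge0 // expR_ge0.
apply: (@le_trans _ _ (\sum_(S0 : {set T} | (#|S0| <= K * a)%N) (#|T| ^ (2 * a.+1))%:R * E)).
  rewrite (eq_bigl (fun S0 : {set T} => (#|S0| <= K * a)%N)); last by move=> S0; rewrite a2.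
  apply: ler_sum => S0 SK; rewrite sumr_const -[_ *+ #|_|]mulr_natl ler_wpM2r // ler_nat.
  have : (#|S0| <= K * a.+1)%N by rewrite (leq_trans SK) // leq_mul2l leqnSn orbT.
  move=> /(candidate_count (a := a.+1) _) h; apply: leq_trans (h _); last by apply: leq_trans a2 _.
  by apply/eq_leq/eq_card => g; rewrite [RHS]inE.
rewrite sumr_const -[_ *+ #|_|]mulr_natl mulrA -natrM /rho exprMn -/E -natrX -natrX.
rewrite ler_wpM2r // ler_nat.
apply: (@leq_trans ((#|T| ^ 2) ^ (K * a) * #|T| ^ (2 * a.+1))).
  rewrite leq_mul2r; apply/orP; right.
  apply: (@leq_trans (#|T|.+1 ^ (K * a))).
    by apply: leq_trans (card_small_sets T (K * a)); apply/eq_leq/eq_card => S0; rewrite [RHS]inE.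
  have [->|Ka0] := posnP (K * a)%N; first by rewrite !expn0.
  by rewrite leq_exp2r //; nia.
rewrite -!expnM -expnD leq_exp2l //.
nia.
Qed.
End Sum.
End Candidates.

(** * Probability of a small separator *)

Section Degrees.
Variables (R : realType) (T : finType) (e : rel T) (d : nat).
Hypothesis e_reg : regular_graph e d.

Definition degrees_within (W : {set T}) (lo hi : R) : bool :=
  [forall v, lo <= #|nbhd e v :&: W|%:R <= hi].

Lemma degrees_concentrate (p eta : R) : 0 <= p <= 1 -> 0 < eta <= 1 ->
  expectation p (fun W => (~~ degrees_within W ((1 - eta) * (p * d%:R)) ((1 + eta) * (p * d%:R)))%:R)
  <= 2 * #|T|%:R * expR (- (eta ^+ 2 / 8 * (p * d%:R))).
Proof.
move=> p01 eta01; have card_nbhd v : #|nbhd e v| = d := e_reg v.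
apply: (@le_trans _ _ (expectation p (fun W => \sum_v
   (((1 + eta) * (p * #|nbhd e v|%:R) < #|nbhd e v :&: W|%:R)%R%:R +
    (#|nbhd e v :&: W|%:R < (1 - eta) * (p * #|nbhd e v|%:R))%R%:R)))).
  apply: expectation_le => // W.
  have nonneg v : 0 <= ((1 + eta) * (p * #|nbhd e v|%:R) < #|nbhd e v :&: W|%:R)%R%:R +
    (#|nbhd e v :&: W|%:R < (1 - eta) * (p * #|nbhd e v|%:R))%R%:R :> R by rewrite addr_ge0.
  case: (boolP (degrees_within _ _ _)) => [_|]; first by apply: sumr_ge0.
  rewrite negb_forall => /existsP[v]; rewrite negb_and -!ltNge => hv.
  rewrite (bigD1 v) //= -[X in X <= _]addr0; apply: lerD; last by apply: sumr_ge0.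
  rewrite card_nbhd; case/orP: hv => ->; last by rewrite lerDl.
  by rewrite lerDr.
rewrite expectation_sum.
apply: (@le_trans _ _ (\sum_(v : T) (2 * expR (- (eta ^+ 2 / 8 * (p * d%:R)))))).
  apply: ler_sum => v _; rewrite expectationD.
  have := chernoff_upper (nbhd e v) p01 eta01; have := chernoff_lower (nbhd e v) p01 eta01.
  by rewrite card_nbhd; lra.
by rewrite sumr_const -[_ *+ #|_|]mulr_natl; lra.
Qed.
End Degrees.

Section Union.
Variables (R : realType) (T : finType) (e : rel T) (d : nat).
Hypothesis e_sym : symmetric e.
Hypothesis e_reg : regular_graph e d.
Hypothesis d_gt0 : (0 < d)%N.
Hypothesis T_gt1 : (1 < #|T|)%N.
Variable w : T -> T -> R.
Hypothesis w_ge0 : forall u v, 0 <= w u v.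
Hypothesis w_edge : forall u v, w u v != 0 -> e u v.
Hypothesis w_row : forall u, \sum_v w u v = 1.
Hypothesis w_col : forall v, \sum_u w u v = 1.
Hypothesis w_spread : spreading e w.
Variables (Q : R) (K : nat).
Hypothesis Q_gt0 : 0 < Q.
Hypothesis Q_large : 34 * (80 * 96) * K%:R <= Q.

Definition crossing (W0 S0 : {set T}) (g : T -> T) (A B : {set T}) : R :=
  \sum_(u in A) \sum_(v in B) w u v * color_mismatch e W0 Q S0 g u v.

Definition bad_candidates (W0 A B : {set T}) : R :=
  \sum_(S0 : {set T}) \sum_(g : {ffun T -> T} | candidate e W0 Q K S0 g)
    (crossing W0 S0 g A B <= 2 * K%:R * (color_count g)%:R)%R%:R.

Variables (q r : R).
Hypothesis q01 : 0 <= q <= 1.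
Hypothesis r01 : 0 <= r <= 1.
Let rho : R :=
  #|T|%:R ^+ (4 + 2 * K) * expR (2 * K%:R - q * r / 4 * (d%:R / (80 * 96))).
Hypothesis rho_small : rho <= 1 / 2.

(** Markov's inequality for the exponential of minus the surviving weight. *)
Lemma expectation_bad_candidates (W0 : {set T}) :
  (forall v, Q / 2 <= #|nbhd e v :&: W0|%:R <= 2 * Q) ->
  expectation q (fun A => expectation r (fun B => bad_candidates W0 A B)) <= rho.
Proof.
move=> W0_deg; have /andP[q0 q1] := q01; have /andP[r0 r1] := r01.
have kap0 : 0 <= q * r / 4 by rewrite divr_ge0 ?mulr_ge0.
apply: le_trans (candidate_sum e_sym e_reg d_gt0 w_ge0 w_row w_col w_spread Q_gt0 W0_deg Q_large kap0 rho_small T_gt1).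
have -> : expectation q (fun A => expectation r (fun B => bad_candidates W0 A B)) =
  \sum_(S0 : {set T}) \sum_(g : {ffun T -> T} | candidate e W0 Q K S0 g)
   expectation q (fun A => expectation r (fun B =>
    (crossing W0 S0 g A B <= 2 * K%:R * (color_count g)%:R)%R%:R)).
  transitivity (expectation q (fun A => \sum_(S0 : {set T})
      \sum_(g : {ffun T -> T} | candidate e W0 Q K S0 g) expectation r (fun B =>
      (crossing W0 S0 g A B <= 2 * K%:R * (color_count g)%:R)%R%:R : R))).
    congr expectation; apply/funext => A; rewrite /bad_candidates expectation_sum.
    by apply: eq_bigr => S0 _; exact: expectation_sum.
  rewrite expectation_sum; apply: eq_bigr => S0 _; exact: expectation_sum.
apply: ler_sum => S0 _; apply: ler_sum => g _.
set t := 2 * K%:R * _.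
apply: (@le_trans _ _ (expectation q (fun A => expectation r (fun B =>
   expR t * expR (- crossing W0 S0 g A B))))).
  apply: expectation_le => // A; apply: expectation_le => // B.
  case: (boolP (crossing _ _ _ _ _ <= t)) => h; last by rewrite mulr_ge0 ?expR_ge0.
  rewrite -expRD -[leLHS]/(1 : R); apply: le_trans (expR_ge1Dx _); rewrite lerDl subr_ge0 //.
have -> : expectation q (fun A => expectation r (fun B => expR t * expR (- crossing W0 S0 g A B))) =
   expR t * expectation q (fun A => expectation r (fun B => expR (- crossing W0 S0 g A B))).
  rewrite -expectationZ; congr expectation; apply/funext => A; exact: expectationZ.
rewrite expRD ler_wpM2l ?expR_ge0 // /crossing.
have cm0 u v := color_mismatch_ge0 e W0 Q S0 g u v.
have cm1 u v := color_mismatch_le1 Q_gt0 W0_deg S0 g u v.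
have wle u v : w u v * color_mismatch e W0 Q S0 g u v <= w u v by rewrite ler_piMr.
apply: le_trans (bilinear_laplace_le q01 r01 _ _ _) _.
- by move=> u v; rewrite mulr_ge0.
- by move=> u; rewrite -(w_row u); apply: ler_sum.
- by move=> v; rewrite -(w_col v); apply: ler_sum.
- by rewrite cut_weight_mismatch.
Qed.

Variables (eps eta p P q' : R).
Hypothesis p01 : 0 <= p <= 1.
Hypothesis P_def : P = p * d%:R.
Hypothesis PQ : P = 3 * Q.
Hypothesis Q_def : Q = q * d%:R.
Hypothesis split_p : 1 - p = (1 - q) * (1 - q').
Hypothesis split_q : 1 - q' = (1 - q) * (1 - r).
Hypothesis eps_small : 0 < eps <= 1 / 2.
Hypothesis eta_def : eta = eps / 6.
Hypothesis K_eps : 2 <= K%:R * eps.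
Hypothesis K_Q : K%:R < Q / 8.
Hypothesis Q_ge : 96 <= Q.
Hypothesis etaQ : 4 <= eta * Q.

Let typical W := degrees_within e W ((1 - eta) * P) ((1 + eta) * P).
Let typical0 W0 := degrees_within e W0 (Q / 2) (2 * Q).

(** If all degrees are typical, failure of toughness exhibits a candidate whose
    surviving cut weight is small: [S0] is the part of the separator in the first
    round, and the colouring is given by the components. *)
Lemma not_tough_covered (A B C : {set T}) :
  (~~ tough (induced_subgraph e (A :|: (B :|: C))) (1 - eps))%:R <=
  (~~ typical (A :|: (B :|: C)))%:R + (~~ typical0 A)%:R + (typical0 A)%:R * bad_candidates A B C :> R.
Proof.
set W := A :|: (B :|: C); have /andP[eps0 eps1] := eps_small.
have bad0 : 0 <= bad_candidates A B C by apply: sumr_ge0 => S0 _; apply: sumr_ge0.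
have [tW|_] := boolP (typical W); last first.
  by case: (tough _ _); case: (typical0 A); rewrite ?mul0r ?mul1r ?addr0 ?add0r ?lerDl ?addr_ge0.
have [tA|_] := boolP (typical0 A); last by case: (tough _ _); rewrite ?mul0r ?addr0 ?add0r ?ler01.
rewrite !add0r mul1r.
have [//|nt] := boolP (tough (induced_subgraph e W) (1 - eps)).
have s0 : 0 <= 1 - eps by lra.
have [S [c [SW c_edge k2 Sk]]] := not_tough_separator e_sym s0 nt.
have AW : A \subset W by apply: finset.subsetUl.
have BW : B \subset W by rewrite /W finset.setUCA finset.subsetUl.
have CW : C \subset W by rewrite /W finset.setUA finset.subsetUr.
have A_deg v : Q / 2 <= #|nbhd e v :&: A|%:R <= 2 * Q by move/forallP: tA.
have W_deg v : (1 - eta) * P <= #|nbhd e v :&: W|%:R <= (1 + eta) * P by move/forallP: tW.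
have eta01 : 0 < eta <= 1 / 12 by rewrite eta_def; lra.
have [t2 SKt] := separator_splits_core e_sym AW Q_gt0 A_deg c_edge PQ eta01 W_deg Q_ge etaQ
  eps_small eta_def K_eps K_Q k2 Sk.
set S0 := S :&: A in t2 SKt; set I := sampled_core e A Q S0 in t2 SKt.
have I0 : I != finset.set0.
  by apply: contraTneq t2 => ->; rewrite imset0 cards0.
pose g : {ffun T -> T} := [ffun x => c (retract I x)].
have gc x : x \in I -> g x = c x by move=> xI; rewrite ffunE retract_id.
have g_co : coarsens (comp_coloring e A Q S0) g.
  apply/coarsensP => x y; rewrite !ffunE.
  exact: (label_comp e_sym AW c_edge).
have g_count : color_count g = #|[set c v | v in I]|.
  rewrite (color_count_core I0 g_co); congr #|pred_of_set _|; exact: eq_in_imset.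
have g_cand : candidate e A Q K S0 g.
  rewrite /candidate I0 g_co g_count t2 /=; apply: leq_trans SKt.
  by apply: subset_leq_card; apply: finset.subsetIl.
have g_cross : crossing A S0 g B C <= 2 * K%:R * (color_count g)%:R.
  apply: le_trans (crossing_le AW Q_gt0 A_deg c_edge w_ge0 w_edge w_row w_col gc BW CW) _.
  by rewrite -mulrA ler_wpM2l // g_count -natrM ler_nat.
rewrite /bad_candidates (bigD1 S0) //= (bigD1 g) //= g_cross -addrA lerDl.
by rewrite addr_ge0 // sumr_ge0 // => S1 _; apply: sumr_ge0.
Qed.

Lemma expectation_not_tough :
  expectation p (fun W => (~~ tough (induced_subgraph e W) (1 - eps))%:R) <=
  2 * #|T|%:R * expR (- (eta ^+ 2 / 8 * P)) + 2 * #|T|%:R * expR (- ((1 / 2) ^+ 2 / 8 * Q)) + rho.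
Proof.
have eta1 : 0 < eta <= 1 by rewrite eta_def; have /andP[? ?] := eps_small; lra.
have half1 : 0 < (1 / 2 : R) <= 1 by lra.
have rho0 : 0 <= rho by rewrite mulr_ge0 ?exprn_ge0 ?expR_ge0.
have W_tail : expectation p (fun W => (~~ typical W)%:R) <=
    2 * #|T|%:R * expR (- (eta ^+ 2 / 8 * P)).
  by rewrite /typical P_def; apply: degrees_concentrate.
have A_tail : expectation q (fun A => (~~ typical0 A)%:R) <=
    2 * #|T|%:R * expR (- ((1 / 2) ^+ 2 / 8 * Q)).
  rewrite Q_def; apply: le_trans (degrees_concentrate e_reg q01 half1).
  apply: expectation_le => // A; rewrite ler_nat.
  case: (boolP (typical0 A)) => // nt; case: (boolP (degrees_within _ _ _ _)) => // /forallP dw.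
  case/negP: nt; apply/forallP => v; have := dw v; rewrite -Q_def; have := Q_gt0; lra.
have cond_tail : expectation q (fun A => (typical0 A)%:R * expectation q (fun B =>
    expectation r (fun C => bad_candidates A B C))) <= rho.
  rewrite -[X in _ <= X](expectation_cst T q); apply: expectation_le => // A.
  have [/forallP tA|_] := boolP (typical0 A); last by rewrite mul0r.
  by rewrite mul1r expectation_bad_candidates.
rewrite (expectation_setU _ split_p).
under eq_fun do rewrite (expectation_setU _ split_q).
apply: (@le_trans _ _ (expectation q (fun A => expectation q (fun B => expectation r (fun C =>
  (~~ typical (A :|: (B :|: C)))%:R + (~~ typical0 A)%:R + (typical0 A)%:R * bad_candidates A B C))))).
  by do 3 (apply: expectation_le => // ?); apply: not_tough_covered.
have -> : expectation q (fun A => expectation q (fun B => expectation r (fun C =>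
  (~~ typical (A :|: (B :|: C)))%:R + (~~ typical0 A)%:R + (typical0 A)%:R * bad_candidates A B C))) =
  expectation p (fun W => (~~ typical W)%:R) + expectation q (fun A => (~~ typical0 A)%:R) +
  expectation q (fun A => (typical0 A)%:R * expectation q (fun B =>
    expectation r (fun C => bad_candidates A B C))).
  rewrite (expectation_setU _ split_p) -!expectationD; congr expectation; apply/funext => A.
  rewrite (expectation_setU _ split_q) -[(~~ typical0 A)%:R in RHS](expectation_cst T q).
  rewrite -expectationZ -!expectationD; congr expectation; apply/funext => B.
  rewrite -[X in _ = _ + X + _](expectation_cst T r).
  by rewrite -expectationZ -!expectationD.
by rewrite !lerD.
Qed.
End Union.

Lemma expR_neg_le_half (R : realType) (z : R) : 1 <= z -> expR (- z) <= 1 / 2.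
Proof.
move=> z1; have := expR_ge1Dx z; have := expRxMexpNx_1 z; have := expR_gt0 (- z).
move=> e0 e1 e2; have := ler_wpM2r (ltW e0) e2; rewrite e1.
have := ler_wpM2r (ltW e0) z1; lra.
Qed.

Lemma ln_ge1 (R : realType) (n : nat) : (4 <= n)%N -> 1 <= ln (n%:R : R).
Proof.
move=> n4; have n0 : 0 < (n%:R : R) by rewrite ltr0n (leq_trans _ n4).
rewrite -ler_expR lnK ?posrE //; apply: (@le_trans _ _ 4); last by rewrite ler_nat.
have h : expR (- (1 / 2)) >= 1 / 2 :> R by apply: le_trans (expR_ge1Dx _); lra.
have e2 : expR (1 / 2) <= 2 :> R.
  have := expRxMexpNx_1 (1 / 2 : R); have := ler_wpM2l (expR_ge0 (1 / 2 : R)) h; lra.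
have -> : (1 : R) = 1 / 2 + 1 / 2 by lra.
by rewrite expRD; have := ler_pM (expR_ge0 _) (expR_ge0 _) e2 e2; lra.
Qed.

Lemma tough_weaken (R : numDomainType) (T : finType) (e : rel T) (s s' : R) :
  s <= s' -> tough e s' -> tough e s.
Proof.
move=> ss /forallP h; apply/forallP => S; apply/implyP => k2.
by apply: le_trans (implyP (h S) k2); rewrite ler_wpM2r.
Qed.

Section Bound.
Variables (R : realType) (eps eta : R) (K : nat).
Hypothesis eps_small : 0 < eps <= 1 / 2.
Hypothesis eta_def : eta = eps / 6.
Hypothesis K_eps : 2 <= K%:R * eps.
Hypothesis K_gt0 : (0 < K)%N.
Variables (T : finType) (e : rel T) (d : nat) (p z : R).
Hypothesis T_ge4 : (4 <= #|T|)%N.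
Hypothesis e_sym : symmetric e.
Hypothesis e_conn : graph_connected e.
Hypothesis e_reg : regular_graph e d.
Hypothesis e_vt : vertex_transitive e.
Hypothesis p01 : 0 <= p <= 1.
Hypothesis z_def : p ^+ 2 * d%:R = 72 * (80 * 96) * z.
Hypothesis z_large : (6 / eta ^+ 2 + 4 + 4 * K%:R) * ln (#|T|%:R : R) <= z.

Lemma not_tough_exponentially_rare :
  expectation p (fun W => (~~ tough (induced_subgraph e W) (1 - eps))%:R) <=
  expR (- (eta ^+ 2 / 2 * z)).
Proof.
have /andP[eps0 eps1] := eps_small; have /andP[p0 p1] := p01.
have l1 := ln_ge1 R T_ge4; have zl := z_large; have zd := z_def; set l := ln _ in l1 zl.
have n_exp : #|T|%:R = expR l by rewrite lnK // posrE ltr0n (leq_trans _ T_ge4).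
have eta0 : 0 < eta by rewrite eta_def; lra.
have eta1 : eta <= 1 / 12 by rewrite eta_def; lra.
have e2_0 : 0 < eta ^+ 2 by rewrite exprn_gt0.
have e2_1 : eta ^+ 2 <= 1.
  by rewrite expr2; have := ler_pM (ltW eta0) (ltW eta0) eta1 eta1; lra.
have K1 : 1 <= K%:R :> R by rewrite ler1n.
have inv0 : 0 < 6 / eta ^+ 2 by rewrite divr_gt0.
have l0 : 0 <= l by lra.
have Kl : K%:R <= K%:R * l by rewrite ler_peMr //; lra.
have il : 6 / eta ^+ 2 <= 6 / eta ^+ 2 * l by rewrite ler_peMr // ltW.
have zK : 4 * K%:R * l + 4 * l <= z.
  by have := mulr_ge0 (ltW inv0) l0; move: zl; lra.
have z4 : 4 <= z by lra.
have zi : 6 / eta ^+ 2 * l <= z by have := mulr_ge0 (ltW (lt_le_trans ltr01 K1)) l0; move: zl; lra.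
have z6 : 6 * l <= eta ^+ 2 * z.
  have := ler_wpM2l (ltW e2_0) zi.
  by have -> : eta ^+ 2 * (6 / eta ^+ 2 * l) = 6 * l by field; rewrite gt_eqF.
have dpos : (0 < d)%N.
  rewrite lt0n; apply: contraTneq z4 => d0; rewrite -ltNge.
  by move: zd; rewrite d0 mulr0; lra.
have p_gt0 : 0 < p.
  rewrite lt0r p0 andbT; apply: contraTneq z4 => p_0; rewrite -ltNge.
  by move: zd; rewrite p_0 expr0n mul0r; lra.
(* The density [r] of the last round is chosen so that the union of the three
   rounds is exactly [p]-random; it is at least [q] as [(1 - q)^3 >= 1 - p]. *)
pose q := p / 3; pose r := 1 - (1 - p) / (1 - q) ^+ 2; pose q' := 1 - (1 - q) * (1 - r).
have q01 : 0 <= q <= 1 by rewrite /q; lra.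
have q1 : 0 < 1 - q by rewrite /q; lra.
have q1n : 1 - q != 0 by rewrite gt_eqF.
have q2pos : 0 < (1 - q) ^+ 2 by rewrite exprn_gt0.
have qr : q <= r.
  rewrite /r lerBrDr -lerBrDl ler_pdivrMr // -exprS /q.
  rewrite -subr_ge0.
  have -> : (1 - p / 3) ^+ 3 - (1 - p) = p ^+ 2 * (9 - p) / 27 by field.
  by rewrite divr_ge0 // mulr_ge0 ?sqr_ge0 //; lra.
have r01 : 0 <= r <= 1.
  apply/andP; split; first by apply: le_trans qr; case/andP: q01.
  by rewrite /r gerBl divr_ge0 ?subr_ge0 // ltW.
have split_p : 1 - p = (1 - q) * (1 - q').
  by rewrite /q' /r; field.
have split_q : 1 - q' = (1 - q) * (1 - r) by rewrite /q'; ring.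
pose P := p * d%:R; pose Q := q * d%:R.
have PQ : P = 3 * Q by rewrite /P /Q /q; field.
have zP : 72 * (80 * 96) * z <= P.
  rewrite -zd /P expr2 -mulrA ler_piMl //; by rewrite mulr_ge0.
have Q0 : 0 < Q by lra.
have Q_large : 34 * (80 * 96) * K%:R <= Q by lra.
have K_Q : K%:R < Q / 8 by lra.
have Q96 : 96 <= Q by lra.
have etaQ : 4 <= eta * Q.
  have h : 4 <= eta ^+ 2 * z by lra.
  have h2 : eta ^+ 2 * z <= eta * z.
    by rewrite expr2 -mulrA ler_piMl //; [rewrite mulr_ge0 //; lra | lra].
  have h3 : z <= Q by lra.
  by have := ler_wpM2l (ltW eta0) h3; lra.
have [w [w_ge0 w_edge w_row w_col w_spread]] := spreading_weight_exists R e_conn e_vt T_ge4.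
have rho_le : #|T|%:R ^+ (4 + 2 * K) * expR (2 * K%:R - q * r / 4 * (d%:R / (80 * 96))) <= expR (- z).
  rewrite n_exp -expRM_natl -expRD ler_expR natrD natrM.
  have : 2 * z <= q * r / 4 * (d%:R / (80 * 96)).
    have -> : 2 * z = q * q / 4 * (d%:R / (80 * 96)).
      have -> : z = p ^+ 2 * d%:R / (72 * (80 * 96)) by rewrite zd; field.
      by rewrite /q; field.
    rewrite ler_wpM2r ?divr_ge0 // ?mulr_ge0 // ler_wpM2r //.
    by rewrite ler_wpM2l //; case/andP: q01.
  lra.
have rho_half := le_trans rho_le (expR_neg_le_half (le_trans (ler1n _ 4) z4)).
have T1 : (1 < #|T|)%N by apply: leq_trans T_ge4.
have main := expectation_not_tough e_sym e_reg dpos T1 w_ge0 w_edge w_row w_col w_spread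
  Q0 Q_large q01 r01 rho_half p01 (erefl P) PQ (erefl Q) split_p split_q eps_small eta_def
  K_eps K_Q Q96 etaQ.
apply: le_trans main _.
have ez0 : 0 <= eta ^+ 2 * z by rewrite mulr_ge0 ?(ltW e2_0) //; lra.
have t1 : expR (- (eta ^+ 2 / 8 * P)) <= expR (- (eta ^+ 2 * z)).
  rewrite ler_expR lerN2; have := ler_wpM2l (ltW e2_0) zP; lra.
have ez : eta ^+ 2 * z <= z by rewrite ler_piMl //; lra.
have t2 : expR (- ((1 / 2) ^+ 2 / 8 * Q)) <= expR (- (eta ^+ 2 * z)).
  rewrite ler_expR lerN2 expr2; lra.
have t3 : expR (- z) <= expR (- (eta ^+ 2 * z)) by rewrite ler_expR lerN2.
set E := expR (- (eta ^+ 2 * z)) in t1 t2 t3.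
have n4 : 4 <= #|T|%:R :> R by rewrite ler_nat.
apply: (@le_trans _ _ (#|T|%:R ^+ 3 * E)).
  have E0 : 0 <= E by apply: expR_ge0.
  apply: (@le_trans _ _ ((4 * #|T|%:R + 1) * E)).
    have := ler_wpM2l (_ : 0 <= 2 * #|T|%:R :> R) t1; have := ler_wpM2l (_ : 0 <= 2 * #|T|%:R :> R) t2.
    have n0 : 0 <= 2 * #|T|%:R :> R by lra.
    by move=> /(_ n0) h1 /(_ n0) h2; lra.
  rewrite ler_wpM2r //.
  have n0 : 0 <= #|T|%:R :> R by [].
  have := ler_pM (ler0n R 4) (ler0n R 4) n4 n4 => h.
  by have := ler_wpM2r n0 h; rewrite !exprS expr0 mulr1; lra.
rewrite n_exp -expRM_natl /E -expRD ler_expR; lra.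
Qed.
End Bound.

Import numFieldNormedType.Exports.

Local Open Scope classical_set_scope.
Local Open Scope ring_scope.

Theorem theorem1p3 (R : realType) (eps : R) (heps : 0 < eps) :
  exists2 c : R, 0 < c &
    forall (f : nat -> R) (hf : f n @[n --> \oo] --> +oo),
    exists N : nat,
    forall (T : finType) (e : rel T) (d : nat) (p : R),
      (N <= #|T|)%N ->
      simple_graph e ->
      graph_connected e ->
      regular_graph e d ->
      vertex_transitive e ->
      0 <= p <= 1 ->
      f #|T| <= p ^+ 2 * d%:R / ln (#|T|%:R : R) ->
      1 - 2 `^ (- (c * (p ^+ 2 * d%:R))) <=
        prob_random_subset p (fun W : {set T} => tough (induced_subgraph e W) (1 - eps)).
Proof.
pose eps' : R := Num.min eps (1 / 2).
have eps'0 : 0 < eps' by rewrite lt_min heps; lra.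
have eps'_small : 0 < eps' <= 1 / 2 by rewrite eps'0 ge_min lexx orbT.
pose eta := eps' / 6; have eta0 : 0 < eta by rewrite divr_gt0.
pose K := (Num.truncn (2 / eps')).+1.
have K_eps : 2 <= K%:R * eps'.
  rewrite -ler_pdivrMr //; apply: ltW; rewrite /K.
  by have /andP[] := truncn_itv (ltW (divr_gt0 (ltr0n R 2) eps'0)).
(* The denominator [M] is the scale of the final exponent: with [q] one third of
   [p], [q^2 / 4 * (d / (80 * 96))] is twice [p^2 * d / M]. *)
pose M : R := 72 * (80 * 96).
have M0 : 0 < M by rewrite !mulr_gt0 ?ltr0n.
exists (eta ^+ 2 / 2 / M); first by rewrite !divr_gt0 ?exprn_gt0.
move=> f /cvgryPge hf.
have [N _ hN] := hf (M * (6 / eta ^+ 2 + 4 + 4 * K%:R)).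
exists (maxn N 4) => T e d p; rewrite geq_max => /andP[NT T4] [e_sym _] conn reg vt p01 fp.
have l1 := ln_ge1 R T4.
pose z := p ^+ 2 * d%:R / M.
have zM : p ^+ 2 * d%:R = M * z by rewrite /z; field; rewrite gt_eqF.
have z_large : (6 / eta ^+ 2 + 4 + 4 * K%:R) * ln (#|T|%:R : R) <= z.
  have := le_trans (hN _ NT) fp; rewrite ler_pdivlMr ?zM; last by apply: lt_le_trans l1.
  by rewrite -mulrA ler_pM2l.
have small := not_tough_exponentially_rare eps'_small (erefl eta) K_eps (ltn0Sn _) T4 e_sym conn reg vt p01 zM z_large.
have -> : prob_random_subset p (fun W : {set T} => tough (induced_subgraph e W) (1 - eps)) =
    expectation p (fun W => (tough (induced_subgraph e W) (1 - eps))%:R).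
  rewrite /prob_random_subset big_mkcond; apply: eq_bigr => W _.
  by case: (tough _ _); rewrite ?mulr1 ?mulr0.
apply: (@le_trans _ _ (1 - expectation p (fun W => (~~ tough (induced_subgraph e W) (1 - eps'))%:R))).
  rewrite lerD2l lerN2; apply: le_trans small _; rewrite zM.
  have -> : eta ^+ 2 / 2 / M * (M * z) = eta ^+ 2 / 2 * z by field; rewrite gt_eqF.
  set y := eta ^+ 2 / 2 * z.
  have z0 : 0 <= z by apply: divr_ge0 (ltW M0); rewrite mulr_ge0 ?sqr_ge0.
  have y0 : 0 <= y by rewrite mulr_ge0 // divr_ge0 // sqr_ge0.
  rewrite /powR pnatr_eq0 /= ler_expR mulNr lerN2 ler_piMr //.
  by rewrite -ler_expR lnK ?posrE //; have := expR_ge1Dx (1 : R); lra.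
rewrite -[X in X - _](expectation_cst T p 1) lerBlDr -expectationD.
apply: expectation_le => // W; have [tW|_] := boolP (tough _ (1 - eps')); last first.
  by rewrite lerDr.
by rewrite addr0 (tough_weaken _ tW) // lerD2l lerN2 ge_min lexx.
Qed.
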